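(* Let $(V,Y_V^{c}(z),c,\rho)$ be a graded vertex operator coalgebra with coproduct map $Y_V^{c}(z)=\Upsilon(z)$ and with $\rho\in V_2^*$, and let $(\mathcal M,\Upsilon_{\mathcal M}(z))$ be an admissible $V$-comodule, $\mathcal M=\bigoplus_{s\in\mathbb N}M(s)$, all of whose homogeneous subspaces $M(s)$ are finite dimensional. Let $\mathcal M'=\bigoplus_{s\in\mathbb N}M(s)^*$ be the graded dual of $\mathcal M$ and define $\Upsilon'_{\mathcal M'}(z):\mathcal M'\to (V\otimes\mathcal M')[[z,z^{-1}]]$ by $$\big(\Upsilon'_{\mathcal M'}(z)m^*,\,f\otimes m\big)=\Big(f\otimes m^*,\ \big((-z^{-2})^{L_V(0)}e^{zL_V(-1)}\otimes \mathrm{Id}\big)\circ\Upsilon_{\mathcal M}(z^{-1})m\Big)$$ for all $m\in\mathcal M$, $m^*\in\mathcal M'$, $f\in V'$. Then $(\mathcal M',\Upsilon'_{\mathcal M'}(z))$ is also an admissible $V$-comodule.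
   Context: Everything is over $\mathbb C$; $\tau(v\otimes w)=w\otimes v$; $\delta(x)=\sum_{n\in\mathbb Z}x^n$; $(z_1+z_2)^n$ is expanded in nonnegative powers of the second variable; $(\cdot,\cdot)$ is the natural pairing of a space with its dual (in either order). A graded vertex operator coalgebra is a tuple $(V,\Upsilon(z),c,\rho)$: a $\mathbb Z$-graded space $V=\bigoplus_s V_s$ with $\dim V_s<\infty$, $V_s=0$ for $s\ll0$; linear maps $c,\rho:V\to\mathbb C$; a linear map $\Upsilon(z):V\to (V\otimes V)[[z,z^{-1}]]$, $v\mapsto\sum_{k\in\mathbb Z}\Delta_k(v)z^{-k-1}$, such that: (i) each $\Delta_k(v)\in V\otimes V$ and $\Delta_k(v)=0$ for $k\ll0$; $\Delta_k$ is homogeneous of degree $k+1$, i.e. $\Delta_k(V_s)\subset (V\otimes V)_{s+k+1}$; (ii) $(c\otimes\mathrm{Id})\Upsilon(z)v=v$, $(\mathrm{Id}\otimes c)\Upsilon(z)v\in V[[z]]$, with limit $v$ as $z\to0$; (iii) Jacobi identity $$z_0^{-1}\delta\big(\tfrac{z_1-z_2}{z_0}\big)(\mathrm{Id}\otimes\Upsilon(z_2))\Upsilon(z_1)-z_0^{-1}\delta\big(\tfrac{z_2-z_1}{-z_0}\big)(\tau\otimes\mathrm{Id})(\mathrm{Id}\otimes\Upsilon(z_1))\Upsilon(z_2)=z_1^{-1}\delta\big(\tfrac{z_2+z_0}{z_1}\big)(\Upsilon(z_0)\otimes\mathrm{Id})\Upsilon(z_2);$$ (iv) writing $(\rho\otimes\mathrm{Id})\Upsilon(z)=\sum_kL_V(k)z^{k-2}$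 with $L_V(k)\in\mathrm{End}(V)$, one has $[L_V(k),L_V(j)]=(k-j)L_V(k+j)+\frac{k^3-k}{12}\delta_{k+j,0}d$ for a constant $d\in\mathbb C$ (the rank); $V_s$ is the eigenspace of $L_V(0)$ with eigenvalue $s$; and $(L_V(1)\otimes\mathrm{Id})\Upsilon(z)=\frac{d}{dz}\Upsilon(z)=\Upsilon(z)L_V(1)-(\mathrm{Id}\otimes L_V(1))\Upsilon(z)$. Put $V'=\bigoplus_sV_s^*$. An admissible $V$-comodule $(\mathcal M,\Upsilon_{\mathcal M}(z))$ is an $\mathbb N$-graded space $\mathcal M=\bigoplus_{t\in\mathbb N}M(t)$ with a linear map $\Upsilon_{\mathcal M}(z):\mathcal M\to (V\otimes\mathcal M)[[z,z^{-1}]]$, $\Upsilon_{\mathcal M}(z)=\sum_k\Delta_{\mathcal M,k}z^{-k-1}$, such that: each $\Delta_{\mathcal M,k}(m)\in V\otimes \mathcal M$ is a finite sum and vanishes for $k\ll0$; $(c\otimes\mathrm{Id})\Upsilon_{\mathcal M}(z)m=m$; the Jacobi identity $$z_0^{-1}\delta\big(\tfrac{z_1-z_2}{z_0}\big)(\mathrm{Id}\otimes\Upsilon_{\mathcal M}(z_2))\Upsilon_{\mathcal M}(z_1)-z_0^{-1}\delta\big(\tfrac{z_2-z_1}{-z_0}\big)(\tau\otimes\mathrm{Id})(\mathrm{Id}\otimes\Upsilon_{\mathcal M}(z_1))\Upsilon_{\mathcal M}(z_2)=z_1^{-1}\delta\big(\tfrac{z_2+z_0}{z_1}\big)(\Upsilon(z_0)\otimes\mathrm{Id})\Upsilon_{\mathcal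 M}(z_2);$$ writing $(\rho\otimes\mathrm{Id})\Upsilon_{\mathcal M}(z)=\sum_kL_V(k)z^{k-2}$ with $L_V(k)\in\mathrm{End}(\mathcal M)$, the same Virasoro relations hold on $\mathcal M$; $(L_V(1)\otimes\mathrm{Id})\Upsilon_{\mathcal M}(z)=\frac{d}{dz}\Upsilon_{\mathcal M}(z)=\Upsilon_{\mathcal M}(z)L_V(1)-(\mathrm{Id}\otimes L_V(1))\Upsilon_{\mathcal M}(z)$; and $\Delta_{\mathcal M,k}(M(t))\subset\bigoplus_{s\in\mathbb N}V_{t+k+1-s}\otimes M(s)$. For a linear map $\phi$, $z^{\phi}v=z^\lambda v$ when $\phi v=\lambda v$; thus $(-z^{-2})^{L_V(0)}v=(-z^{-2})^sv$ for $v\in V_s$. *)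

(* Defs.v *)
(* "Formal series" with coefficients in W are functions from the exponents to W. *)
From HB Require Import structures.
From mathcomp Require Import all_boot all_order all_algebra generic_quotient.
From mathcomp Require Import ring_quotient freeg.
From mathcomp Require Import boolp classical_sets functions cardinality fsbigop.

Set Implicit Arguments.
Unset Strict Implicit.
Unset Printing Implicit Defensive.

Import GRing.Theory.
Local Open Scope classical_set_scope.
Local Open Scope quotient_scope.
Local Open Scope ring_scope.

Section Span.
Context {K : fieldType} {U : lmodType K}.

Definition lspan (S : set U) : set U :=
  [set x | exists (n : nat) (a : 'I_n -> K) (u : 'I_n -> U),
     (forall i, S (u i)) /\ x = \sum_(i < n) a i *: u i].

Definition subspace (A : set U) :=
  A 0 /\ forall a u v, A u -> A v -> A (a *: u + v).

Definition finite_dim (A : set U) := exists s : seq U, A = lspan [set` s].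

Lemma lspan_gen S x : S x -> lspan S x.
Proof.
move=> Sx; exists 1%N, (fun=> 1), (fun=> x); split=> //.
by rewrite big_ord1 scale1r.
Qed.

Lemma subspace_lspan S : subspace (lspan S).
Proof.
split; first by exists 0%N, (fun=> 0), (fun=> 0); split=> [[]//|]; rewrite big_ord0.
move=> a u v [n [b [x [Sx ->]]]] [m [c [y [Sy ->]]]].
exists (n + m)%N, (fun i => match fintype.split i with inl i => a * b i | inr i => c i end),
  (fun i => match fintype.split i with inl i => x i | inr i => y i end).
split=> [i|]; first by case: fintype.split.
rewrite big_split_ord scaler_sumr; congr (_ + _); apply: eq_bigr => i _.
  by rewrite -[lshift _ _]/(unsplit (inl i)) unsplitK scalerA.
by rewrite -[rshift _ _]/(unsplit (inr i)) unsplitK.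
Qed.

Lemma lspan_min S A : subspace A -> S `<=` A -> lspan S `<=` A.
Proof.
move=> [A0 Al] SA _ [n [a [u [Su ->]]]].
elim/big_rec: _ => // i x _ Ax; apply: Al => //; exact: SA.
Qed.

End Span.

(* V ⊗ W is the free module on V * W modulo the relations of bilinearity. *)
Section Tensor.
Context {K : fieldType}.
Variables V W : lmodType K.

Definition tensor_relations : set {freeg (V * W)%type / K} :=
  [set r | (exists a v v' w,
              r = << (a *: v + v', w) >> - (a *: << (v, w) >> + << (v', w) >>))
        \/ (exists a v w w',
              r = << (v, a *: w + w') >> - (a *: << (v, w) >> + << (v, w') >>))].

Definition tensor_kernel : {pred {freeg (V * W)%type / K}} :=
  fun r => `[< lspan tensor_relations r >].

Lemma tensor_kernel_zmod : zmod_closed tensor_kernel.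
Proof.
have [k0 kl] := subspace_lspan tensor_relations.
split=> [|x y /asboolP kx /asboolP ky]; first exact/asboolP.
by apply/asboolP; rewrite addrC -scaleN1r; exact: kl.
Qed.

HB.instance Definition _ :=
  GRing.isZmodClosed.Build _ tensor_kernel tensor_kernel_zmod.

Definition tensor := Quotient.quot tensor_kernel.
HB.instance Definition _ := GRing.Zmodule.on tensor.
HB.instance Definition _ := Quotient.on tensor.

Lemma tensor_reprK (x : tensor) : \pi_tensor (repr x) = x.
Proof. exact: reprK. Qed.

Lemma tensor_eqP (x y : {freeg (V * W)%type / K}) :
  (\pi_tensor x = \pi_tensor y) <-> lspan tensor_relations (x - y).
Proof.
split=> [/eqmodP|h]; first by move=> /asboolP.
by apply/eqmodP; exact/asboolP.
Qed.

Definition tscale (a : K) (x : tensor) : tensor := \pi_tensor (a *: repr x).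

Lemma pi_tscale a x : tscale a (\pi_tensor x) = \pi_tensor (a *: x).
Proof.
apply/tensor_eqP; rewrite -scalerBr -[X in lspan _ X]addr0.
have [k0 kl] := subspace_lspan tensor_relations; apply: (kl) => //.
by apply/tensor_eqP; rewrite reprK.
Qed.

Lemma pi_tadd x y : \pi_tensor x + \pi_tensor y = \pi_tensor (x + y).
Proof. by rewrite [LHS]piE. Qed.

Fact tscaleA a b x : tscale a (tscale b x) = tscale (a * b) x.
Proof. by rewrite -(tensor_reprK x) !pi_tscale scalerA. Qed.
Fact tscale1 : left_id 1 tscale.
Proof. by move=> x; rewrite -(tensor_reprK x) pi_tscale scale1r. Qed.
Fact tscaleDr : right_distributive tscale +%R.
Proof.
move=> a x y; rewrite -(tensor_reprK x) -(tensor_reprK y) pi_tadd !pi_tscale pi_tadd.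
by rewrite scalerDr.
Qed.
Fact tscaleDl x : {morph tscale^~ x : a b / a + b}.
Proof. by move=> a b /=; rewrite -(tensor_reprK x) !pi_tscale pi_tadd scalerDl. Qed.

HB.instance Definition _ := GRing.Zmodule_isLmodule.Build K tensor
  tscaleA tscale1 tscaleDr tscaleDl.

Lemma pi_scale a x : a *: \pi_tensor x = \pi_tensor (a *: x).
Proof. exact: pi_tscale. Qed.

Definition tens (v : V) (w : W) : tensor := \pi_tensor << (v, w) >>.

Lemma tens_linear_l w : linear (tens^~ w).
Proof.
move=> a v v'; rewrite /tens pi_scale pi_tadd; apply/tensor_eqP.
by apply: lspan_gen; left; exists a, v, v', w.
Qed.

Lemma tens_linear_r v : linear (tens v).
Proof.
move=> a w w'; rewrite /tens pi_scale pi_tadd; apply/tensor_eqP.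
by apply: lspan_gen; right; exists a, v, w, w'.
Qed.

End Tensor.

Notation "V ⊗ W" := (tensor V%type W%type) (at level 40, left associativity) : type_scope.
Notation "v ⊗ w" := (tens v w) (at level 40, left associativity) : ring_scope.

Section UniversalProperty.
Context {K : fieldType} {V W U : lmodType K}.

(* The linear map V ⊗ W -> U induced by B; only meaningful for bilinear B
   (see tliftE), like every construction below that is derived from it. *)
Definition tlift (B : V -> W -> U) (x : V ⊗ W) : U :=
  fglift (fun p => B p.1 p.2) (repr x).

Definition bilinear_map (B : V -> W -> U) :=
  (forall w, linear (B^~ w)) /\ (forall v, linear (B v)).

Let F B : {freeg (V * W)%type / K} -> U := fglift (fun p => B p.1 p.2).

Lemma fglift_linear B : linear (F B).
Proof.
have FB := @lift_is_additive K (V * W)%type U (fun p => B p.1 p.2).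
pose G := GRing.isZmodMorphism.Build _ _ (F B) FB.
pose FA : {additive _ -> _} := HB.pack (F B) G.
have FU k x : F B << k *g x >> = k *: B x.1 x.2 by exact: liftU.
have FE D : F B D = \sum_(z <- dom D) coeff z D *: B z.1 z.2.
  rewrite -{1}[D]freeg_sumE -[F B]/(FA : _ -> _) raddf_sum.
  by apply: eq_bigr => i _; exact: FU.
move=> a x y; rewrite -[F B]/(FA : _ -> _) raddfD /=; congr (_ + _).
rewrite [in RHS]FE scaler_sumr [a *: x]/(fgscale a x) /fgscale.
rewrite -[F B]/(FA : _ -> _) raddf_sum; apply: eq_bigr => i _ /=.
by rewrite FU scalerA.
Qed.

Section Bilinear.
Variable B : V -> W -> U.
Hypothesis bilB : bilinear_map B.

Lemma tlift_pi x : tlift B (\pi_(V ⊗ W) x) = F B x.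
Proof.
have: lspan (@tensor_relations K V W) (repr (\pi_(V ⊗ W) x) - x).
  by apply/tensor_eqP; rewrite reprK.
have FL := fglift_linear B.
have F0 : F B 0 = 0.
  have := FL (- 1) 0 0; rewrite scaler0 addr0 => ->.
  by rewrite scaleN1r addNr.
have FB u v : F B (u - v) = F B u - F B v.
  by have := FL (- 1) v u; rewrite !scaleN1r [- v + u]addrC [- F B v + _]addrC.
have ker : subspace [set r | F B r = 0].
  by split=> [//|a u v /= u0 v0]; rewrite FL u0 v0 scaler0 addr0.
have FU x0 : F B << x0 >> = B x0.1 x0.2 by rewrite /F liftU scale1r.
move=> h; have : F B (repr (\pi_(V ⊗ W) x) - x) = 0.
  apply: (lspan_min ker _ h) => _ [[a [v [v' [w ->]]]]|[a [v [w [w' ->]]]]] /=;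
  rewrite FB FL !FU /=.
    by rewrite (bilB.1 w) subrr.
  by rewrite (bilB.2 v) subrr.
by rewrite FB => /eqP; rewrite subr_eq0 => /eqP.
Qed.

Lemma tliftE v w : tlift B (v ⊗ w) = B v w.
Proof. by rewrite tlift_pi /F liftU scale1r. Qed.

Lemma tlift_linear : linear (tlift B).
Proof.
move=> a x y; rewrite -(tensor_reprK x) -(tensor_reprK y) pi_scale pi_tadd !tlift_pi.
exact: fglift_linear.
Qed.

End Bilinear.

Lemma tens_span (x : V ⊗ W) : lspan [set v ⊗ w | v in setT & w in setT] x.
Proof.
rewrite -(tensor_reprK x) -[repr x]freeg_sumE; set P := [set _ | _ in _ & _ in _].
have [s0 sl] := subspace_lspan P.
have pi0 : \pi_(V ⊗ W) 0 = 0 by apply: (addrI (\pi_(V ⊗ W) 0)); rewrite pi_tadd !addr0.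
elim: (dom _) => [|z s IH]; first by rewrite big_nil pi0.
rewrite big_cons -pi_tadd.
have -> : << coeff z (repr x) *g z >> = coeff z (repr x) *: << z >>
    :> {freeg (V * W)%type / K}.
  apply/eqP/freeg_eqP => y; rewrite coeffZ !coeffU; by rewrite mul1r.
rewrite -pi_scale; apply: sl => //; apply: lspan_gen.
by exists z.1 => //; exists z.2 => //; case: z.
Qed.

End UniversalProperty.

Section TensorMaps.
Context {K : fieldType}.

Definition tmap {V W V' W' : lmodType K} (f : V -> V') (g : W -> W') :
    V ⊗ W -> V' ⊗ W' :=
  tlift (fun v w => f v ⊗ g w).

Definition tswap {V W : lmodType K} : V ⊗ W -> W ⊗ V :=
  tlift (fun v w => w ⊗ v).

Definition tassoc {U V W : lmodType K} : U ⊗ (V ⊗ W) -> (U ⊗ V) ⊗ W :=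
  tlift (fun u => tlift (fun v w => (u ⊗ v) ⊗ w)).

(* f ⊗ Id and Id ⊗ f for a linear form f, with K ⊗ W and W ⊗ K identified
   with W *)
Definition tforml {V W : lmodType K} (f : V -> K) : V ⊗ W -> W :=
  tlift (fun v w => f v *: w).
Definition tformr {V W : lmodType K} (f : V -> K) : W ⊗ V -> W :=
  tlift (fun w v => f v *: w).

(* pairing of V ⊗ W with f ⊗ g, for linear forms f and g *)
Definition tpair {V W : lmodType K} (f : V -> K) (g : W -> K) : V ⊗ W -> K :=
  tlift (fun v w => f v * g w : K^o).

End TensorMaps.

Section Grading.
Context {K : fieldType} {I : choiceType} {V : lmodType K}.
Implicit Type G : I -> set V.

Definition decomposition G (v : V) (x : I -> V) :=
  [/\ forall i, G i (x i), finite_set [set i | x i != 0]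
    & v = \sum_(i \in [set: I]) x i].

Definition graded_by G :=
  (forall i, subspace (G i)) /\ forall v, exists! x, decomposition G v x.

Definition hcomp G (i : I) (v : V) : V := xget (fun=> 0) (decomposition G v) i.

End Grading.

(* The graded dual \bigoplus_i (G i)^*, realized as the space of the linear forms
   on V = \bigoplus_i G i that vanish on all but finitely many of the G i. *)
Section GradedDual.
Context {K : fieldType} {I : choiceType} {V : lmodType K}.
Variable G : I -> set V.

Definition gdual_pred : {pred V -> K^o} := fun f =>
  `[< linear f /\ finite_set [set i | exists2 v, G i v & f v != 0] >].

Lemma gdual_pred_submod : submod_closed gdual_pred.
Proof.
split=> [|a f g /asboolP[fl ff] /asboolP[gl gf]].
  apply/asboolP; split=> [a u v|]; first by rewrite scaler0 addr0.
  by apply: (sub_finite_set _ (finite_set0 _)) => i [v _]; rewrite eqxx.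
apply/asboolP; split=> [b u v|].
  rewrite /= !fctE fl gl !scalerDr !scalerA [b * a]mulrC -!addrA.
  by congr (_ + _); rewrite addrCA.
have fU := conj ff gf; rewrite -finite_setU in fU; apply: sub_finite_set fU.
move=> i [v Gv]; rewrite !fctE => nz.
have [fv0|fv0] := eqVneq (f v) 0; last by left; exists v.
by right; exists v => //; move: nz; rewrite fv0 scaler0 add0r.
Qed.

HB.instance Definition _ :=
  GRing.isSubmodClosed.Build K (V -> K^o) gdual_pred gdual_pred_submod.

Record gdual := Gdual { gdual_fun :> V -> K^o; gdualP : gdual_fun \in gdual_pred }.

HB.instance Definition _ := [isSub for gdual_fun].
HB.instance Definition _ := [Choice of gdual by <:].
HB.instance Definition _ := [SubChoice_isSubLmodule of gdual by <:].

(* (G i)^* *)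
Definition gdual_part (i : I) : set gdual :=
  [set f | forall j v, j <> i -> G j v -> f v = 0].

End GradedDual.

Section FormalCalculus.
Context {K : fieldType}.

Definition binomz (n : int) (j : nat) : K :=
  (\prod_(i < j) (n%:~R - i%:R)) / j`!%:R.

(* coefficient of x^p y^q in (x + e y)^n, expanded in nonnegative powers of y *)
Definition binom_coef (e : K) (n p q : int) : K :=
  match q with
  | Posz j => if p + q == n then e ^+ j * binomz n j else 0
  | Negz _ => 0
  end.

(* exponents of (z0, z1, z2) *)
Definition expo3 := (int * int * int)%type.
Definition mk_expo3 (a b c : int) : expo3 := (a, b, c).

(* product of a scalar series and a W-valued series in z0, z1, z2 *)
Definition fsmul {W : lmodType K} (a : expo3 -> K) (F : expo3 -> W) : expo3 -> W :=
  fun n => \sum_(i \in [set: expo3]) a i *: F (n - i).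

(* z0^-1 delta((z1 - z2) / z0) = \sum_n z0^(-n-1) (z1 - z2)^n *)
Definition delta_12_0 (i : expo3) : K :=
  let: (i0, i1, i2) := i in binom_coef (- 1) (- i0 - 1) i1 i2.

(* z0^-1 delta((z2 - z1) / - z0) = \sum_n (-1)^n z0^(-n-1) (z2 - z1)^n *)
Definition delta_21_0 (i : expo3) : K :=
  let: (i0, i1, i2) := i in
  (- 1) ^ (- i0 - 1) * binom_coef (- 1) (- i0 - 1) i2 i1.

(* z1^-1 delta((z2 + z0) / z1) = \sum_n z1^(-n-1) (z2 + z0)^n *)
Definition delta_20_1 (i : expo3) : K :=
  let: (i0, i1, i2) := i in binom_coef 1 (- i1 - 1) i2 i0.

End FormalCalculus.

Section Comodules.
Context {K : fieldType} {V M : lmodType K}.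

(* coefficient of z^n in Upsilon(z) = \sum_k D k z^(-k-1) *)
Definition zcoef {W U : Type} (D : int -> W -> U) (n : int) : W -> U := D (- n - 1).

Definition truncated {W : Type} {U : lmodType K} (D : int -> W -> U) :=
  forall w, exists N : int, forall k : int, (k < N)%R -> D k w = 0.

Section Jacobi.
Variables (DV : int -> V -> V ⊗ V) (DM : int -> M -> V ⊗ M).

(* the three compositions in the Jacobi identity, as series in z0, z1, z2 with
   values in (V ⊗ V) ⊗ M *)
Definition comp_12 (m : M) (n : expo3) : (V ⊗ V) ⊗ M :=
  let: (n0, n1, n2) := n in
  if n0 == 0 then tassoc (tmap id (zcoef DM n2) (zcoef DM n1 m)) else 0.

Definition comp_21 (m : M) (n : expo3) : (V ⊗ V) ⊗ M :=
  let: (n0, n1, n2) := n in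
  if n0 == 0 then
    tmap tswap id (tassoc (tmap id (zcoef DM n1) (zcoef DM n2 m)))
  else 0.

Definition comp_02 (m : M) (n : expo3) : (V ⊗ V) ⊗ M :=
  let: (n0, n1, n2) := n in
  if n1 == 0 then tmap (zcoef DV n0) id (zcoef DM n2 m) else 0.

Definition jacobi := forall (m : M) (n : expo3),
  fsmul delta_12_0 (comp_12 m) n - fsmul delta_21_0 (comp_21 m) n
  = fsmul delta_20_1 (comp_02 m) n.
End Jacobi.

(* (rho ⊗ Id) Upsilon(z) = \sum_k L(k) z^(k-2) *)
Definition Lop (rho : V -> K) (D : int -> M -> V ⊗ M) (k : int) (m : M) : M :=
  tforml rho (zcoef D (k - 2) m).

Definition virasoro (L : int -> M -> M) (d : K) := forall (k j : int) (m : M),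
  L k (L j m) - L j (L k m)
  = (k - j)%:~R *: L (k + j) m
    + (if k + j == 0 then (k ^+ 3 - k)%:~R / 12%:R * d else 0) *: m.

Definition counit_left (c : V -> K) (D : int -> M -> V ⊗ M) :=
  forall (m : M) (n : int),
    tforml c (zcoef D n m) = if n == 0 then m else 0.

Definition L1_derivative (LV : int -> V -> V) (LM : int -> M -> M)
    (D : int -> M -> V ⊗ M) :=
  forall (m : M) (n : int),
    tmap (LV 1) id (zcoef D n m) = (n + 1)%:~R *: zcoef D (n + 1) m
    /\ (n + 1)%:~R *: zcoef D (n + 1) m
       = zcoef D n (LM 1 m) - tmap id (LM 1) (zcoef D n m).

End Comodules.

(* d is the rank of the coalgebra. *)
Record graded_voc (K : fieldType) (V : lmodType K) (gV : int -> set V)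
    (DV : int -> {linear V -> (V ⊗ V)%type}) (c rho : {linear V -> K^o}) (d : K) : Prop :=
  GradedVOC {
    voc_graded : graded_by gV;
    voc_finite : forall s, finite_dim (gV s);
    voc_bounded : exists N : int, forall s : int, (s < N)%R -> gV s = [set 0];
    voc_truncated : truncated DV;
    voc_degree : forall (k s : int) v, gV s v ->
      lspan [set x | exists a b u w,
               [/\ a + b = s + k + 1, gV a u, gV b w & x = u ⊗ w]] (DV k v);
    voc_counit_left : counit_left c DV;
    voc_counit_right : forall (v : V) (n : int),
      (n <= 0)%R -> tformr c (zcoef DV n v) = if n == 0 then v else 0;
    voc_jacobi : jacobi DV DV;
    voc_virasoro : virasoro (Lop rho DV) d;
    voc_eigenspace : forall s : int, gV s = [set v | Lop rho DV 0 v = s%:~R *: v];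
    voc_L1 : L1_derivative (Lop rho DV) (Lop rho DV) DV
  }.

Record admissible_comodule (K : fieldType) (V : lmodType K) (gV : int -> set V)
    (DV : int -> {linear V -> (V ⊗ V)%type}) (c rho : {linear V -> K^o}) (d : K)
    (M : lmodType K) (gM : nat -> set M) (DM : int -> {linear M -> (V ⊗ M)%type}) : Prop :=
  AdmissibleComodule {
    com_graded : graded_by gM;
    com_truncated : truncated DM;
    com_counit : counit_left c DM;
    com_jacobi : jacobi DV DM;
    com_virasoro : virasoro (Lop rho DM) d;
    com_L1 : L1_derivative (Lop rho DV) (Lop rho DM) DM;
    com_degree : forall (k : int) (t : nat) m, gM t m ->
      lspan [set x | exists (s : nat) v w,
               [/\ gV (t%:Z + k + 1 - s%:Z) v, gM s w & x = v ⊗ w]] (DM k m)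
  }.

Section Contragredient.
Context {K : fieldType} {V : lmodType K}.
Variables (gV : int -> set V) (L : int -> V -> V).

(* coefficient of z^j in e^(z L(-1)) *)
Definition exp_coef (j : int) (v : V) : V :=
  match j with
  | Posz k => (k`!%:R)^-1 *: iter k (L (- 1)) v
  | Negz _ => 0
  end.

(* coefficient of z^i in (-z^-2)^L(0), which multiplies gV s by (-1)^s z^(-2s) *)
Definition zpow_coef (i : int) (v : V) : V :=
  \sum_(s \in [set s : int | - (2 * s) = i]) (- 1) ^ s *: hcomp gV s v.

(* coefficient of z^p in (-z^-2)^L(0) e^(z L(-1)) *)
Definition twist_coef (p : int) (v : V) : V :=
  \sum_(i \in [set: int]) zpow_coef i (exp_coef (p - i) v).

(* The equation between (D'(z) m', f ⊗ m) and
   (f ⊗ m', (((-z^-2)^L(0) e^(z L(-1))) ⊗ Id) D(z^-1) m), coefficient of z^n by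
   coefficient of z^n; z^q has in D(z^-1) the coefficient that z^-q has in D(z). *)
Definition contragredient {M : lmodType K} {gM : nat -> set M}
    (D : int -> M -> V ⊗ M) (D' : int -> gdual gM -> V ⊗ gdual gM) :=
  forall (m : M) (m' : gdual gM) (f : gdual gV) (n : int),
    tpair f (fun g : gdual gM => g m) (zcoef D' n m')
    = \sum_(p \in [set: int])
        tpair f m' (tmap (twist_coef p) id (zcoef D (- (n - p)) m)).

End Contragredient.

(* Main.v *)
From HB Require Import structures.
Require Import Defs.
From mathcomp Require Import all_boot all_order all_algebra finmap ring lra zify.
From mathcomp Require Import boolp classical_sets functions cardinality fsbigop filter.
From mathcomp Require Import reals complex.

Set Implicit Arguments.
Unset Strict Implicit.
Unset Printing Implicit Defensive.

Import Order.TTheory GRing.Theory Num.Theory.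
Local Open Scope ring_scope.

(** The graded dual V' is a vertex operator algebra with vacuum c and conformal
    vector ρ, and M is a right module over it: a form f on V acts on M by the
    operators f_n, where f_n is the coefficient of z^n in (f ⊗ Id) Υ_M(z).  The
    theorem is then the dual of the classical fact that the contragredient of a
    module is a module.

    Everything is proved coefficient by coefficient, with finite sums.  Write L
    for the transpose of L_V(-1), an operator of degree -1 on V'.  As V is
    bounded below, L is locally nilpotent on V', and for f of degree b the
    coefficient of z^n in the pairing of Υ'(z) with f is the transpose of the
    finite sum [adjoint_act]
      f*_n = (-1)^b Σ_q (f L^q / q!)_(q - 2b - n),
    an endomorphism of M of degree n + b.  So Υ'(z)m', paired with forms, takes
    values in the degrees allowed by the grading; since the homogeneous
    subspaces have finite dimension, these values come from exactly one tensor
    in V ⊗ M' ([contragredient_exists], [tens_pair_separate]).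

    Paired with two forms f and g, the Jacobi identity becomes Borcherds'
    identity ([jacobi_borcherds], [borcherds_jacobi]): two sums of products of
    an operator of f and an operator of g, in both orders, against a sum of
    operators of the products of f and g in V'.  Insert the sums above in the
    identity for Υ'.  On the side of the operator products there is nothing to
    compute: inverting z exchanges the two expansions, and after reindexing one
    finds a combination of instances of the identity for M, for the forms
    f L^j / j! and g L^k / k! ([aop_borcherds]).  What remains is an identity
    between products of forms in V' ([star_dpow]), the coefficientwise version
    of the formula for the conjugation of a vertex operator by exp(zL(1)) and
    z^L(0).  It is graded by the total order e in L and in the binomial
    expansion, both sides satisfy the same recursion in e ([conjugation]), and
    the only input is the commutator of L with a product ([Ldual_star]),
    which is an instance of the Jacobi identity of V.

    The other axioms are short.  The forms c and ρ are killed by L, because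
    c ∘ L_V(k) = 0 for k < 2 and ρ = c ∘ L_V(2); hence L_M'(k) is the
    transpose of L_M(-k), and the counit and Virasoro axioms pass to M'.  The
    derivative of Υ' comes from the commutator of L_M(-1) with f*_n ([aop_L])
    and from the Jacobi identity for M'. *)

(** * Linear maps and sums of finite support *)

Section LinearMaps.
Context {K : fieldType} {U W : lmodType K} {f : U -> W} (lin_f : linear f).

(** A linear map of tensor products that is built from other maps is linear only
    if they are, so linearity is mostly at hand as a property of the function. *)
Definition mklinear : {linear U -> W} :=
  HB.pack f (GRing.isLinear.Build K U W *:%R f lin_f).

Lemma lin0 : f 0 = 0. Proof. exact: (linear0 mklinear). Qed.
Lemma linD : {morph f : x y / x + y}. Proof. exact: (linearD mklinear). Qed.
Lemma linB : {morph f : x y / x - y}. Proof. exact: (linearB mklinear). Qed.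
Lemma linZ a : {morph f : x / a *: x}. Proof. exact: (linearZ_LR mklinear). Qed.
Lemma lin_sum I (r : seq I) (P : pred I) (F : I -> U) :
  f (\sum_(i <- r | P i) F i) = \sum_(i <- r | P i) f (F i).
Proof. exact: (linear_sum mklinear). Qed.
End LinearMaps.

Section FiniteSupport.
Local Open Scope classical_set_scope.
Context {W : zmodType}.

Lemma fsum_inj {T : choiceType} (e : nat -> T) (F : T -> W) J :
  injective e ->
  (forall i, (forall j, (j < J)%N -> i <> e j) -> F i = 0) ->
  \sum_(i \in [set: T]) F i = \sum_(j < J) F (e j).
Proof.
move=> inj_e F0.
rewrite -(big_mkord xpredT (fun j => F (e j))) /index_iota subn0 -(big_map e xpredT F) /=.
rewrite [RHS]fsbig_seq ?map_inj_uniq ?iota_uniq //.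
symmetry; apply: (fsbig_widen [set` map e (iota 0 J)] setT F) => // i [_ /= ni].
apply: F0 => j ltjJ eij; apply: ni.
by rewrite eij; apply: map_f; rewrite mem_iota.
Qed.

Lemma fsum_int (F : int -> W) (P : int) (J : nat) :
  (forall i, ~ (P <= i < P + J%:Z) -> F i = 0) ->
  \sum_(i \in [set: int]) F i = \sum_(j < J) F (P + j%:Z).
Proof.
move=> F0; apply: (fsum_inj (e := fun j => P + j%:Z)) => [j k /addrI[]//|i ni].
apply: F0 => /andP[lePi ltiJ]; apply: (ni `|i - P|%N); lia.
Qed.

Lemma fsum_single {T : choiceType} (i0 : T) (F : T -> W) :
  (forall i, i <> i0 -> F i = 0) -> \sum_(i \in [set: T]) F i = F i0.
Proof.
move=> F0; transitivity (\sum_(i \in [set i0]) F i); last by rewrite fsbig_set1.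
symmetry; apply: (fsbig_widen [set i0] setT F) => // i [_ /=].
by move=> ni; apply: F0.
Qed.

End FiniteSupport.

(** * Subspaces and linear independence *)

Section Span.
Local Open Scope classical_set_scope.
Context {K : fieldType} {U : lmodType K}.

Lemma subspace_sum (A : set U) I (r : seq I) (P : pred I) (F : I -> U) :
  subspace A -> (forall i, P i -> A (F i)) -> A (\sum_(i <- r | P i) F i).
Proof.
move=> [A0 Al] AF; elim/big_rec: _ => // i x Pi Ax.
by rewrite -[F i]scale1r; apply: Al => //; exact: AF.
Qed.

Lemma subspace_scale (A : set U) a u : subspace A -> A u -> A (a *: u).
Proof. by move=> [A0 Al] Au; rewrite -[_ *: _]addr0; exact: Al. Qed.

Lemma subspace_ker (W : lmodType K) (f : U -> W) :
  linear f -> subspace [set u | f u = 0].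
Proof.
move=> lf; split=> [|a u v /= u0 v0]; first exact: (lin0 lf).
by rewrite lf u0 v0 scaler0 addr0.
Qed.

Lemma subspace_eq (W : lmodType K) (f g : U -> W) :
  linear f -> linear g -> subspace [set u | f u = g u].
Proof.
move=> lf lg; split=> [|a u v /= u0 v0]; first by rewrite /= (lin0 lf) (lin0 lg).
by rewrite lf lg u0 v0.
Qed.

Definition independent n (w : 'I_n -> U) :=
  forall a : 'I_n -> K, \sum_i a i *: w i = 0 -> forall i, a i = 0.

(** One member of a dependent family can be dropped; this is what makes the
    families of minimal length chosen below independent. *)
Lemma dependentP n (w : 'I_n -> U) : ~ independent w ->
  exists (m : nat) (e : n = m.+1) (k : 'I_m.+1) (b : 'I_m -> K),
    w (cast_ord (esym e) k) = \sum_j b j *: w (cast_ord (esym e) (lift k j)).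
Proof.
case: n w => [|n] w dep; first by case: dep => a _ [].
move: dep => /existsNP[a /not_implyP[a0 /existsNP[k ak]]].
exists n, (erefl _), k, (fun j => - (a k)^-1 * a (lift k j)).
have ce (i : 'I_n.+1) : cast_ord (esym (erefl n.+1)) i = i by exact: val_inj.
rewrite ce; under eq_bigr do rewrite ce -scalerA.
rewrite -scaler_sumr.
move: a0; rewrite (bigD1_ord k) //= => /eqP; rewrite addr_eq0 => /eqP e.
have {e} e : \sum_(j < n) a (lift k j) *: w (lift k j) = - (a k *: w k).
  by rewrite e opprK.
by rewrite e scalerN scaleNr opprK scalerA mulVf ?scale1r //; exact/eqP.
Qed.

End Span.

(** * Tensor products *)

Section Tensors.
Local Open Scope classical_set_scope.
Context {K : fieldType}.
Implicit Types V W U : lmodType K.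

Lemma tens_ind V W (A : set (V ⊗ W)) :
  subspace A -> (forall v w, A (v ⊗ w)) -> forall x, A x.
Proof.
move=> sA Avw x; apply: (lspan_min sA) (tens_span x) => _ [v _ [w _ <-]].
exact: Avw.
Qed.

Lemma tens_ext V W U (f g : V ⊗ W -> U) : linear f -> linear g ->
  (forall v w, f (v ⊗ w) = g (v ⊗ w)) -> f =1 g.
Proof. by move=> lf lg fg; apply: tens_ind => //; exact: subspace_eq. Qed.

Lemma tmap_bilinear V W V' W' (f : V -> V') (g : W -> W') :
  linear f -> linear g -> bilinear_map (fun v w => f v ⊗ g w).
Proof.
move=> lf lg; split=> [w|v] a x y; first by rewrite lf tens_linear_l.
by rewrite lg tens_linear_r.
Qed.

Lemma tmap_linear V W V' W' (f : V -> V') (g : W -> W') :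
  linear f -> linear g -> linear (tmap f g).
Proof. by move=> lf lg; exact/tlift_linear/tmap_bilinear. Qed.

Lemma tmapE V W V' W' (f : V -> V') (g : W -> W') v w :
  linear f -> linear g -> tmap f g (v ⊗ w) = f v ⊗ g w.
Proof. by move=> lf lg; rewrite /tmap tliftE //; exact: tmap_bilinear. Qed.

Lemma id_linear V : linear (@id V). Proof. by []. Qed.

Lemma tswap_bilinear V W : bilinear_map (fun (v : V) (w : W) => w ⊗ v).
Proof. by split=> ? a x y; rewrite (tens_linear_l, tens_linear_r). Qed.

Lemma tswap_linear V W : linear (@tswap K V W).
Proof. exact/tlift_linear/tswap_bilinear. Qed.

Lemma tswapE V W (v : V) (w : W) : tswap (v ⊗ w) = w ⊗ v.
Proof. by rewrite /tswap tliftE //; exact: tswap_bilinear. Qed.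

Lemma tassoc_bilinear2 U V W (u : U) :
  bilinear_map (fun (v : V) (w : W) => (u ⊗ v) ⊗ w).
Proof.
split=> [w|v] a x y; last by rewrite tens_linear_r.
by rewrite tens_linear_r tens_linear_l.
Qed.

Lemma tassoc_bilinear U V W :
  bilinear_map (fun u : U => tlift (fun (v : V) (w : W) => (u ⊗ v) ⊗ w)).
Proof.
split=> [x a u u'|u]; last exact/tlift_linear/tassoc_bilinear2.
have l u0 := tlift_linear (@tassoc_bilinear2 U V W u0).
apply: (tens_ext (f := tlift (fun v w => ((a *: u + u') ⊗ v) ⊗ w))
  (g := fun x => a *: tlift (fun v w => (u ⊗ v) ⊗ w) x
                 + tlift (fun v w => (u' ⊗ v) ⊗ w) x)) => [//|b y z|v w] /=.
  rewrite !l !scalerDr !scalerA [b * a]mulrC -!addrA; congr (_ + _).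
  by rewrite addrCA.
by rewrite !tliftE ?tens_linear_l ?tens_linear_l //; exact: tassoc_bilinear2.
Qed.

Lemma tassoc_linear U V W : linear (@tassoc K U V W).
Proof. exact/tlift_linear/tassoc_bilinear. Qed.

Lemma tassocE U V W (u : U) (v : V) (w : W) : tassoc (u ⊗ (v ⊗ w)) = (u ⊗ v) ⊗ w.
Proof.
rewrite /tassoc tliftE; last exact: tassoc_bilinear.
by rewrite tliftE //; exact: tassoc_bilinear2.
Qed.

Lemma tforml_bilinear V W (f : V -> K^o) :
  linear f -> bilinear_map (fun v (w : W) => f v *: w).
Proof.
move=> lf; split=> [w|v] a x y; first by rewrite lf scalerDl scalerA.
by rewrite scalerDr !scalerA mulrC.
Qed.

Lemma tforml_linear V W (f : V -> K^o) :
  linear f -> linear (@tforml K V W f).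
Proof. by move=> lf; exact/tlift_linear/tforml_bilinear. Qed.

Lemma tformlE V W (f : V -> K^o) v (w : W) :
  linear f -> tforml f (v ⊗ w) = f v *: w.
Proof. by move=> lf; rewrite /tforml tliftE //; exact: tforml_bilinear. Qed.

Lemma tformr_bilinear V W (f : V -> K^o) :
  linear f -> bilinear_map (fun (w : W) v => f v *: w).
Proof.
move=> lf; split=> [w|v] a x y; last by rewrite lf scalerDl scalerA.
by rewrite scalerDr !scalerA mulrC.
Qed.

Lemma tformr_linear V W (f : V -> K^o) :
  linear f -> linear (@tformr K V W f).
Proof. by move=> lf; exact/tlift_linear/tformr_bilinear. Qed.

Lemma tformrE V W (f : V -> K^o) v (w : W) :
  linear f -> tformr f (w ⊗ v) = f v *: w.
Proof. by move=> lf; rewrite /tformr tliftE //; exact: tformr_bilinear. Qed.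

Lemma tpair_bilinear V W (f : V -> K^o) (g : W -> K^o) : linear f -> linear g ->
  bilinear_map (fun v w => f v * g w : K^o).
Proof.
move=> lf lg; split=> [w|v] a x y; first by rewrite lf mulrDl -scalerAl.
by rewrite lg mulrDr -scalerAr.
Qed.

Lemma tpair_linear V W (f : V -> K^o) (g : W -> K^o) : linear f -> linear g ->
  linear (tpair f g : V ⊗ W -> K^o).
Proof. by move=> lf lg; exact/tlift_linear/tpair_bilinear. Qed.

Lemma tpairE V W (f : V -> K^o) (g : W -> K^o) v w : linear f -> linear g ->
  tpair f g (v ⊗ w) = f v * g w.
Proof. by move=> lf lg; rewrite /tpair tliftE //; exact: tpair_bilinear. Qed.

Lemma comp_linear V W U (g : W -> U) (f : V -> W) :
  linear f -> linear g -> linear (fun v => g (f v)).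
Proof. by move=> lf lg a x y; rewrite lf lg. Qed.

Lemma tpair_tforml V W (f : V -> K^o) (g : W -> K^o) x : linear f -> linear g ->
  tpair f g x = g (tforml f x).
Proof.
move=> lf lg; move: x; apply: (tens_ext (U := K^o)); first exact: tpair_linear.
  exact/comp_linear/lg/tforml_linear.
by move=> v w; rewrite tpairE // tformlE // (linZ lg).
Qed.

Lemma tpair_tformr V W (f : V -> K^o) (g : W -> K^o) x : linear f -> linear g ->
  tpair f g x = f (tformr g x).
Proof.
move=> lf lg; move: x; apply: (tens_ext (U := K^o)); first exact: tpair_linear.
  exact/comp_linear/lf/tformr_linear.
by move=> v w; rewrite tpairE // tformrE // (linZ lf) mulrC.
Qed.

Lemma tforml_tmap V W V' W' (h : V -> V') (k : W -> W') (f : V' -> K^o) x :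
  linear h -> linear k -> linear f ->
  tforml f (tmap h k x) = k (tforml (fun v => f (h v)) x).
Proof.
move=> lh lk lf; have lfh := comp_linear lh lf.
move: x; apply: tens_ext.
- exact/comp_linear/tforml_linear/lf/tmap_linear.
- exact/comp_linear/lk/tforml_linear.
by move=> v w; rewrite tmapE // !tformlE // (linZ lk).
Qed.

(** This turns iterated coactions into composites of operators: a form on
    V ⊗ W factors through first f, then g. *)
Lemma tforml_tassoc V W U (f : V -> K^o) (g : W -> K^o) (x : V ⊗ (W ⊗ U)) :
  linear f -> linear g ->
  tforml (tpair f g) (tassoc x) = tforml g (tforml f x).
Proof.
move=> lf lg; have lfg := tpair_linear lf lg.
have lgU := @tforml_linear W U g lg.
have lfWU : linear (@tforml K V (W ⊗ U)%type f) by exact: tforml_linear.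
have l1 := comp_linear (@tassoc_linear V W U) (@tforml_linear (V ⊗ W)%type U _ lfg).
have l2 := comp_linear lfWU lgU.
move: x; apply: tens_ext => // v y.
move: y; apply: (tens_ext (f := fun y => tforml (tpair f g) (tassoc (v ⊗ y)))
   (g := fun y => tforml g (tforml f (v ⊗ y)))).
- by move=> a y z; rewrite tens_linear_r l1.
- by move=> a y z; rewrite tens_linear_r l2.
move=> w u; rewrite tassocE !tformlE // tpairE // (linZ lgU) tformlE //.
by rewrite scalerA.
Qed.

Lemma tpair_tswap V W (f : V -> K^o) (g : W -> K^o) x : linear f -> linear g ->
  tpair f g (tswap x) = tpair g f x.
Proof.
move=> lf lg; move: x; apply: (tens_ext (U := K^o)).
- exact/comp_linear/tpair_linear/lg/lf/tswap_linear.
- exact: tpair_linear.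
by move=> v w; rewrite tswapE !tpairE // mulrC.
Qed.

Definition separating V (F : set (V -> K^o)) :=
  (forall f, F f -> linear f) /\ forall v, (forall f, F f -> f v = 0) -> v = 0.

(** A representation of a tensor by as few pure tensors as possible has
    linearly independent right factors, and then every left factor is
    killed by the forms that kill the tensor. *)
Lemma tens_separate V W (F : set (V -> K^o)) (x : V ⊗ W) : separating F ->
  (forall f, F f -> tforml f x = 0) -> x = 0.
Proof.
move=> [linF sepF] x0.
pose Q n := `[< exists (v : 'I_n -> V) (w : 'I_n -> W), x = \sum_i v i ⊗ w i >].
have exQ : exists n, Q n.
  have [n [a [u [Su xE]]]] := tens_span x.
  have /choice[p pE] i : exists p : V * W, u i = p.1 ⊗ p.2.
    by have [v _ [w _ <-]] := Su i; exists (v, w).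
  exists n; apply/asboolP; exists (fun i => a i *: (p i).1), (fun i => (p i).2).
  by rewrite xE; apply: eq_bigr => i _; rewrite pE (linZ (tens_linear_l _)).
case: (ex_minnP exQ) => n /asboolP[v [w xE]] nmin.
have wfree : independent w.
  apply: contrapT => /dependentP[m [nm [k [b wk]]]]; subst n.
  suff /nmin : Q m by rewrite ltnn.
  apply/asboolP; exists (fun j => v (lift k j) + b j *: v k), (fun j => w (lift k j)).
  have ce (i : 'I_m.+1) : cast_ord (esym (erefl m.+1)) i = i by exact: val_inj.
  move: wk; rewrite ce; under eq_bigr do rewrite ce.
  move=> wk; rewrite xE (bigD1_ord k) //= wk (lin_sum (tens_linear_r _)) -big_split.
  apply: eq_bigr => j _ /=; rewrite (linD (tens_linear_l _)) addrC; congr (_ + _).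
  by rewrite (linZ (tens_linear_l _)) (linZ (tens_linear_r _)).
have v0 i : v i = 0.
  apply: sepF => f Ff; have lf := linF f Ff.
  have := x0 f Ff; rewrite xE (lin_sum (tforml_linear lf)).
  under eq_bigr do rewrite tformlE //.
  by move/(wfree (fun i => f (v i))).
by rewrite xE big1 // => i _; rewrite v0 (lin0 (tens_linear_l _)).
Qed.

End Tensors.

(** * Gradings and graded duals *)

Section Gradings.
Local Open Scope classical_set_scope.
Context {K : fieldType} {I : choiceType} {V : lmodType K}.
Implicit Types (G : I -> set V) (i : I).

Lemma fsum_linear (a : K) (x y : I -> V) :
  finite_set [set i | x i != 0] -> finite_set [set i | y i != 0] ->
  \sum_(i \in [set: I]) (a *: x i + y i) =
  a *: (\sum_(i \in [set: I]) x i) + \sum_(i \in [set: I]) y i.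
Proof.
move=> finx finy; have finxy := conj finx finy.
rewrite -finite_setU in finxy; move/finite_fsetP: finxy => [X XE].
have X0 i : i \notin X -> x i = 0 /\ y i = 0.
  move=> iX; have : ~ [set` X] i by exact/negP.
  by rewrite -XE => /not_orP[/negP/negPn/eqP ? /negP/negPn/eqP].
rewrite (fsbigTE X) => [|i /X0[-> ->]]; last by rewrite scaler0 addr0.
rewrite (fsbigTE X) => [|i /X0[]//]; rewrite (fsbigTE X y) => [|i /X0[]//].
by rewrite scaler_sumr -big_split.
Qed.

Section HomogeneousComponents.
Context {G : I -> set V} (HG : graded_by G).

Lemma hcompP v : decomposition G v (fun i => hcomp G i v).
Proof.
have [x [xv _]] := HG.2 v; rewrite /hcomp.
by apply: (@xgetPex _ (fun=> 0) (decomposition G v)); exists x.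
Qed.

Lemma hcomp_unique v x i : decomposition G v x -> hcomp G i v = x i.
Proof.
move=> vx; have [y [_ yuniq]] := HG.2 v.
by rewrite -(yuniq _ vx) (yuniq _ (hcompP v)).
Qed.

Lemma hcomp_in i v : G i (hcomp G i v).
Proof. by have [] := hcompP v. Qed.

Lemma hcomp_linear i : linear (hcomp G i).
Proof.
move=> a u v; have [uG uf uE] := hcompP u; have [vG vf vE] := hcompP v.
rewrite (@hcomp_unique _ (fun i => a *: hcomp G i u + hcomp G i v)) //; split.
- by move=> j; apply: (HG.1 j).2.
- have fUV := conj uf vf; rewrite -finite_setU in fUV; apply: sub_finite_set fUV.
  move=> j /=; have [->|] := eqVneq (hcomp G j u) 0; last by left.
  by rewrite scaler0 add0r; right.
- by rewrite fsum_linear // -uE -vE.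
Qed.

Lemma hcomp_id i v j : G i v -> hcomp G j v = if j == i then v else 0.
Proof.
move=> Gv; rewrite (@hcomp_unique _ (fun j => if j == i then v else 0)) //; split.
- by move=> k; case: eqP => [->//|_]; exact: (HG.1 k).1.
- by apply: (sub_finite_set _ (finite_set1 i)) => k /=; case: (eqVneq k i) => // _; rewrite eqxx.
- by rewrite (fsum_single (i0 := i)) ?eqxx // => k /eqP/negPf->.
Qed.

Lemma hcomp_sum v : v = \sum_(i \in [set: I]) hcomp G i v.
Proof. by have [] := hcompP v. Qed.

Lemma hcomp_mem i v : (forall j, j <> i -> hcomp G j v = 0) -> G i v.
Proof.
move=> v0; rewrite [v]hcomp_sum (fsum_single (i0 := i)) //; exact: hcomp_in.
Qed.

Lemma hcomp_eq0 v : (forall i, hcomp G i v = 0) -> v = 0.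
Proof. by move=> v0; rewrite [v]hcomp_sum fsbig1 // => i _. Qed.

Lemma graded_ind (A : set V) : subspace A ->
  (forall i v, G i v -> A v) -> forall v, A v.
Proof.
move=> sA AG v; rewrite [v]hcomp_sum; have [_ + _] := hcompP v.
move=> /finite_fsetP[X XE]; rewrite (fsbigTE X) => [|i iX].
  by apply: subspace_sum => // i _; apply: AG (hcomp_in i v).
by have : ~ [set` X] i by [exact/negP]; rewrite -XE => /negP/negPn/eqP.
Qed.

End HomogeneousComponents.

Section DualForms.
Context {G : I -> set V}.
Implicit Types f g : gdual G.

Lemma gdual_linear f : linear f.
Proof. by case: f => f /= /asboolP[]. Qed.

Lemma gdual_finite f : finite_set [set i | exists2 v, G i v & f v != 0].
Proof. by case: f => f /= /asboolP[]. Qed.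

Lemma gdual_ext f g : f =1 g -> f = g.
Proof. by move=> fg; apply: val_inj; apply: funext. Qed.

Lemma ev_linear v : linear (fun f => f v).
Proof. by []. Qed.

Definition form_gdual (f : V -> K^o) (lin_f : linear f)
  (fin_f : finite_set [set i | exists2 v, G i v & f v != 0]) : gdual G.
Proof. by exists f; apply/asboolP. Defined.

Lemma homogeneous_finite i (f : V -> K^o) :
  (forall j v, j <> i -> G j v -> f v = 0) ->
  finite_set [set j | exists2 v, G j v & f v != 0].
Proof.
move=> f0; apply: (sub_finite_set _ (finite_set1 i)) => j [v Gv].
by apply: contra_neqP => ji; exact: f0 Gv.
Qed.

Lemma gdual_part_subspace i : subspace (gdual_part (G := G) i).
Proof.
split=> [j v _ _|a f g f0 g0 j v ji Gv]; first exact: (lin0 (ev_linear v)).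
by rewrite [LHS]ev_linear (f0 j) // (g0 j) // scaler0 addr0.
Qed.

End DualForms.

Section FiniteDimensionalPieces.
Context {G : I -> set V} (HG : graded_by G).

Lemma gdual_ext_hom (f g : gdual G) :
  (forall i v, G i v -> f v = g v) -> f = g.
Proof.
move=> fg; apply/gdual_ext; apply: (graded_ind HG) => //.
by apply: subspace_eq; exact: gdual_linear.
Qed.

Lemma hom_hcomp i (f : gdual G) v : gdual_part i f -> f (hcomp G i v) = f v.
Proof.
move=> fi; move: v; apply: (graded_ind HG).
  apply: subspace_eq; last exact: gdual_linear.
  exact: comp_linear (hcomp_linear HG i) (gdual_linear f).
move=> j v Gv /=; rewrite (hcomp_id HG _ Gv); case: eqP => // ij.
by rewrite (lin0 (gdual_linear f)) (fi j) // => ji; apply: ij.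
Qed.

Lemma graded_dual_graded : graded_by (gdual_part (G := G)).
Proof.
split=> [i|f]; first exact: gdual_part_subspace.
have lfc i : linear (fun v => f (hcomp G i v)).
  exact: comp_linear (hcomp_linear HG i) (gdual_linear f).
have hfc i j v : j <> i -> G j v -> f (hcomp G i v) = 0.
  move=> ji Gv; rewrite (hcomp_id HG _ Gv); case: eqP => [ij|_].
    by case: ji.
  exact: (lin0 (gdual_linear f)).
pose fc i := form_gdual (lfc i) (homogeneous_finite (hfc i)).
have evsum (x : I -> gdual G) (v : V) i : finite_set [set i | x i != 0] ->
    (forall i, gdual_part i (x i)) -> G i v ->
    (\sum_(i \in [set: I]) x i : gdual G) v = x i v.
  move=> /finite_fsetP[X XE] xG Gv.
  have X0 j : j \notin X -> x j = 0.
    by move=> jX; have : ~ [set` X] j by [exact/negP]; rewrite -XE => /negP/negPn/eqP.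
  rewrite (fsbigTE X) // (lin_sum (ev_linear v)).
  rewrite -(fsbigTE X (fun j => x j v)); last first.
    by move=> j /X0 ->; exact: (lin0 (ev_linear v)).
  by rewrite (fsum_single (i0 := i)) // => j ji; apply: (xG j i) => // ij; apply: ji.
have finfc : finite_set [set i | fc i != 0].
  apply: sub_finite_set (gdual_finite f) => i /=; apply: contra_neqP => /= nv.
  apply: gdual_ext => v; rewrite [RHS](lin0 (ev_linear v)).
  apply: contrapT => /eqP fv; apply: nv; exists (hcomp G i v) => //.
  exact: hcomp_in.
exists fc; split.
  split=> //; apply: gdual_ext_hom => k v Gv.
  by rewrite (evsum _ _ k) //= (hcomp_id HG _ Gv) eqxx.
move=> x [xG finx fE]; apply: funext => i; apply: gdual_ext_hom => j v Gv /=.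
have [ij|/eqP ij] := eqVneq i j; last first.
  rewrite (hfc i j) //; last by move=> ji; apply: ij.
  by rewrite (xG i j) // => ji; apply: ij.
by subst i; rewrite (hcomp_id HG _ Gv) eqxx fE (evsum _ _ j).
Qed.

(** A spanning family of minimal length is independent, so that its coordinates
    are linear; composed with the projection to degree i they are forms in the
    graded dual. *)
Lemma dual_basis i : finite_dim (G i) ->
  exists n (e : 'I_n -> V) (phi : 'I_n -> gdual G),
    [/\ forall j, G i (e j), forall j, gdual_part i (phi j)
      & forall v, hcomp G i v = \sum_j phi j v *: e j].
Proof.
move=> [s sE].
pose spans n (u : 'I_n -> V) :=
  (forall j, G i (u j)) /\ forall v, G i v -> exists a : 'I_n -> K, v = \sum_j a j *: u j.
pose Q n := `[< exists u : 'I_n -> V, spans n u >].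
have exQ : exists n, Q n.
  exists (size s); apply/asboolP; exists (fun j => nth 0 s j); split=> [j|v].
    by rewrite sE; apply: lspan_gen; rewrite /= mem_nth.
  rewrite sE; move: v; apply: lspan_min.
    split=> [|a u v [b ->] [c ->]].
      by exists (fun=> 0); rewrite big1 // => j _; rewrite scale0r.
    exists (fun j => a * b j + c j); rewrite scaler_sumr -big_split /=.
    by apply: eq_bigr => j _; rewrite scalerDl scalerA.
  move=> x /= /[dup] xs; rewrite -index_mem => js.
  exists (fun j => (j == Ordinal js)%:R); rewrite (bigD1 (Ordinal js)) //= eqxx scale1r.
  by rewrite nth_index // big1 ?addr0 // => j /negPf->; rewrite scale0r.
case: (ex_minnP exQ) => n /asboolP[u [uG uS]] nmin.
have ufree : independent u.
  apply: contrapT => /dependentP[m [nm [k [b uk]]]]; subst n.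
  suff /nmin : Q m by rewrite ltnn.
  apply/asboolP; exists (fun j => u (lift k j)); split=> // v /uS[a ->].
  have ce (l : 'I_m.+1) : cast_ord (esym (erefl m.+1)) l = l by exact: val_inj.
  move: uk; rewrite ce; under eq_bigr do rewrite ce.
  move=> uk; exists (fun j => a (lift k j) + a k * b j).
  rewrite (bigD1_ord k) //= uk scaler_sumr -big_split /=.
  by apply: eq_bigr => j _; rewrite scalerDl scalerA addrC.
have /choice[a aE] v := uS _ (hcomp_in HG i v).
have la j : linear (fun v => a v j : K^o).
  move=> c x y; apply/eqP; rewrite -subr_eq0; apply/eqP; move: j; apply: ufree.
  under eq_bigr do rewrite scalerBl scalerDl -scalerA.
  rewrite sumrB big_split /= -scaler_sumr -!aE.
  by rewrite (hcomp_linear HG) subrr.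
have ha j k v : k <> i -> G k v -> a v j = 0.
  move=> ki Gv; move: j; apply: ufree; rewrite -aE (hcomp_id HG _ Gv).
  by case: eqP => // ik; case: ki.
exists n, u, (fun j => form_gdual (la j) (homogeneous_finite (ha j))).
by split=> // j; exact: ha.
Qed.

Hypothesis finG : forall i, finite_dim (G i).

Lemma hom_hcomp_eq0 i v : (forall f : gdual G, gdual_part i f -> f v = 0) ->
  hcomp G i v = 0.
Proof.
move=> v0; have [n [e [phi [_ phiG ->]]]] := dual_basis (finG i).
by rewrite big1 // => j _; rewrite v0 // scale0r.
Qed.

(** The coordinates of the dual bases of the homogeneous subspaces are enough
    forms to tell vectors apart. *)
Lemma hom_separate v :
  (forall i (f : gdual G), gdual_part i f -> f v = 0) -> v = 0.
Proof. by move=> v0; apply: (hcomp_eq0 HG) => i; apply: hom_hcomp_eq0; exact: v0. Qed.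

Lemma hom_separating :
  separating [set f : V -> K^o | exists i (g : gdual G), gdual_part i g /\ f = g].
Proof.
split=> [_ [i [g [_ ->]]]|v v0]; first exact: gdual_linear.
by apply: hom_separate => i f fi; apply: v0; exists i, f.
Qed.

Lemma hom_mem i v :
  (forall j (f : gdual G), j <> i -> gdual_part j f -> f v = 0) -> G i v.
Proof.
move=> v0; apply: (hcomp_mem HG) => j ji; apply: hom_hcomp_eq0 => f.
exact: v0.
Qed.

End FiniteDimensionalPieces.
End Gradings.

(** * Binomial coefficients and diagonal sums *)

Section Binomials.
Context {K : numFieldType}.
Implicit Types (n : int) (j : nat).
Local Notation C := (@binomz K).

Lemma binomz0 n : C n 0 = 1.
Proof. by rewrite /binomz big_ord0 fact0 divr1. Qed.

Lemma binomzS n j : j.+1%:R * C n j.+1 = (n%:~R - j%:R) * C n j.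
Proof.
rewrite /binomz big_ord_recr factS natrM /=.
have j1 : j.+1%:R != 0 :> K by rewrite pnatr_eq0.
have jf : j`!%:R != 0 :> K by rewrite pnatr_eq0 -lt0n fact_gt0.
by field; rewrite jf addrC -natr1 in j1 *.
Qed.

Lemma binomz_absorb n j : j.+1%:R * C n j.+1 = n%:~R * C (n - 1) j.
Proof.
rewrite /binomz big_ord_recl factS natrM /= subr0.
have -> : \prod_(i < j) (n%:~R - (bump 0 i)%:R) = \prod_(i < j) ((n - 1)%:~R - i%:R) :> K.
  by apply: eq_bigr => i _; rewrite /bump add1n rmorphB /= -natr1; ring.
have j1 : j.+1%:R != 0 :> K by rewrite pnatr_eq0.
have jf : j`!%:R != 0 :> K by rewrite pnatr_eq0 -lt0n fact_gt0.
by field; rewrite jf addrC -natr1 in j1 *.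
Qed.

Lemma binomz_pascal n j : C n j.+1 - C (n - 1) j.+1 = C (n - 1) j.
Proof.
apply: (@mulfI _ j.+1%:R); first by rewrite pnatr_eq0.
rewrite mulrBr binomz_absorb binomzS rmorphB /= -natr1; ring.
Qed.

Lemma binomz_small (k j : nat) : (k < j)%N -> C k%:Z j = 0.
Proof.
move=> kj; rewrite /binomz (bigD1 (Ordinal kj)) //=.
by rewrite -[k%:Z%:~R]/(k%:R) subrr mul0r mul0r.
Qed.

End Binomials.

Section DiagonalSums.
Context {K : numFieldType} {W : lmodType K}.

Lemma sum_truncate n n' (F : nat -> W) : (n' <= n)%N ->
  (forall a, (n' <= a)%N -> F a = 0) -> \sum_(a < n) F a = \sum_(a < n') F a.
Proof.
move=> le F0; rewrite -[RHS](big_mkord xpredT F) -[LHS](big_mkord xpredT F) (big_cat_nat (leq0n n') le) //=.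
by rewrite [X in _ + X]big_nat_cond [X in _ + X]big1 ?addr0 // => a /andP[/andP[/F0]].
Qed.

(** The coefficients of total order e in products of two and of three series. *)
Definition diag_sum e (G : nat -> nat -> W) := \sum_(j < e.+1) G (e - j)%N j.
Definition diag_sum3 e (G : nat -> nat -> nat -> W) :=
  diag_sum e (fun a k => diag_sum a (fun i j => G i j k)).

Lemma diag_sum0 G : diag_sum 0 G = G 0%N 0%N.
Proof. by rewrite /diag_sum big_ord1. Qed.

Lemma eq_diag_sum e G G' : (forall i j, (i + j)%N = e -> G i j = G' i j) ->
  diag_sum e G = diag_sum e G'.
Proof. by move=> GG'; apply: eq_bigr => j _; apply: GG'; have := ltn_ord j; lia. Qed.

Lemma eq_diag_sum3 e G G' : (forall i j k, G i j k = G' i j k) ->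
  diag_sum3 e G = diag_sum3 e G'.
Proof. by move=> GG'; apply: eq_diag_sum => a k _; apply: eq_diag_sum => i j _. Qed.

Lemma diag_sumS_r e G :
  diag_sum e.+1 G = G e.+1 0%N + diag_sum e (fun i j => G i j.+1).
Proof. by rewrite /diag_sum big_ord_recl subn0. Qed.

Lemma diag_sumS_l e G :
  diag_sum e.+1 G = G 0%N e.+1 + diag_sum e (fun i j => G i.+1 j).
Proof.
rewrite /diag_sum big_ord_recr /= subnn addrC; congr (_ + _).
by apply: eq_bigr => j _ /=; rewrite subSn // -ltnS.
Qed.

Lemma diag_sumD e G G' :
  diag_sum e (fun i j => G i j + G' i j) = diag_sum e G + diag_sum e G'.
Proof. by rewrite /diag_sum big_split. Qed.

Lemma diag_sumZ e a G : diag_sum e (fun i j => a *: G i j) = a *: diag_sum e G.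
Proof. by rewrite /diag_sum scaler_sumr. Qed.

Lemma diag_sum3D e G G' : diag_sum3 e (fun i j k => G i j k + G' i j k) =
  diag_sum3 e G + diag_sum3 e G'.
Proof. by rewrite -diag_sumD; apply: eq_diag_sum => a k _; rewrite diag_sumD. Qed.

Lemma diag_sum3Z e a G :
  diag_sum3 e (fun i j k => a *: G i j k) = a *: diag_sum3 e G.
Proof. by rewrite -diag_sumZ; apply: eq_diag_sum => b k _; rewrite diag_sumZ. Qed.

Lemma diag_sum_shift e P Q : (forall i j, P i.+1 j = Q i j.+1) ->
  (forall j, P 0%N j = 0) -> (forall i, Q i 0%N = 0) -> diag_sum e P = diag_sum e Q.
Proof.
move=> PQ P0 Q0; case: e => [|e]; first by rewrite !diag_sum0 P0 Q0.
by rewrite diag_sumS_l diag_sumS_r P0 Q0 !add0r; apply: eq_diag_sum => i j _.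
Qed.

(** Euler's identity: the factor e + 1 is the sum i + j of the two indices, and
    each of them is absorbed by a shift of the sum.  It is the coefficientwise
    form of the product rule for a derivative. *)
Lemma diag_sum_weight e G : e.+1%:R *: diag_sum e.+1 G =
  diag_sum e (fun i j => j.+1%:R *: G i j.+1)
  + diag_sum e (fun i j => i.+1%:R *: G i.+1 j).
Proof.
have -> : e.+1%:R *: diag_sum e.+1 G = diag_sum e.+1 (fun i j => j%:R *: G i j)
    + diag_sum e.+1 (fun i j => i%:R *: G i j).
  rewrite -diag_sumD -diag_sumZ; apply: eq_diag_sum => i j <-.
  by rewrite -scalerDl natrD addrC.
by rewrite diag_sumS_r diag_sumS_l !scale0r !add0r.
Qed.

Lemma diag_sum3_weight e G : e.+1%:R *: diag_sum3 e.+1 G =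
  diag_sum3 e (fun i j k => k.+1%:R *: G i j k.+1)
  + diag_sum3 e (fun i j k => j.+1%:R *: G i j.+1 k)
  + diag_sum3 e (fun i j k => i.+1%:R *: G i.+1 j k).
Proof.
rewrite diag_sum_weight -addrA; congr (_ + _).
  by apply: eq_diag_sum => a k _; rewrite diag_sumZ.
by rewrite -diag_sumD; apply: eq_diag_sum => a k _; rewrite diag_sum_weight.
Qed.

Lemma box_sum A B E (G : nat -> nat -> W) : (E <= A)%N -> (E <= B)%N ->
  (forall a b, (E <= a + b)%N -> G a b = 0) ->
  \sum_(a < A) \sum_(b < B) G a b = \sum_(e < E) diag_sum e G.
Proof.
move=> EA EB G0; rewrite exchange_big (@sum_truncate B E (fun b => \sum_(a < A) G a b)) //.
  pose H e b := if (b <= e)%N then G (e - b)%N b else 0.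
  have -> : \sum_(e < E) diag_sum e G = \sum_(e < E) \sum_(b < E) H e b.
    apply: eq_bigr => e _; rewrite (@sum_truncate E e.+1) // => [|b]; last first.
      by rewrite /H ltnNge => /negPf->.
    by apply: eq_bigr => b _; rewrite /H -ltnS ltn_ord.
  rewrite [RHS]exchange_big; apply: eq_bigr => b _ /=.
  rewrite (@sum_truncate A (E - b) (fun a => G a b)); first last.
  - by move=> a aE; apply: G0; lia.
  - by lia.
  rewrite -[RHS](big_mkord xpredT (fun e => H e b)).
  have bE : (b <= E)%N by exact: ltnW.
  rewrite [RHS](big_cat_nat (leq0n b) bE) //=.
  rewrite [X in _ = X + _]big_nat_cond [X in _ = X + _]big1 ?add0r; last first.
    by move=> e /andP[/andP[_ eb] _]; rewrite /H leqNgt eb.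
  have -> : \sum_(b <= e < E) H e b = \sum_(0 + b <= e < E) H e b by rewrite add0n.
  rewrite big_addn big_mkord; apply: eq_bigr => e _.
  by rewrite /H leq_addl addnK.
by move=> b bE; rewrite big1 // => a _; apply: G0; lia.
Qed.

Lemma box_sum3 A B C E (G : nat -> nat -> nat -> W) :
  (E <= A)%N -> (E <= B)%N -> (E <= C)%N ->
  (forall i j k, (E <= i + j + k)%N -> G i j k = 0) ->
  \sum_(j < A) \sum_(k < B) \sum_(i < C) G i j k = \sum_(e < E) diag_sum3 e G.
Proof.
move=> EA EB EC G0; rewrite exchange_big /=.
transitivity (\sum_(k < B) \sum_(a < E) diag_sum a (fun i j => G i j k)).
  apply: eq_bigr => k _; rewrite exchange_big.
  by apply: (@box_sum _ _ E (fun i j => G i j k)) => // i j Eij; apply: G0; lia.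
rewrite exchange_big.
apply: (@box_sum _ _ E (fun a k => diag_sum a (fun i j => G i j k))) => // a k Ek.
by rewrite /diag_sum big1 // => j _; apply: G0; have := ltn_ord j; lia.
Qed.

End DiagonalSums.

(** * The conjugation formula *)

(** Coefficientwise form of the formula that conjugates a vertex operator by
    exp(zL(1)) and z^L(0).  In the application L plays the role of L(1) in the
    algebra of forms, S j k n is the coefficient of z^n in the product of the
    j-th and the k-th divided L-powers of two forms, the first of degree b, and
    D q n is the q-th divided L-power of the coefficient of z^n in their product.
    The parameter a stands for a factor, the a-th power of a binomial, on both
    sides.  Multiplied by e + 1, both
    sides at e + 1 are the image under L of the sides at e, minus a times the
    sides at e with a and n lowered by 1. *)
Section Conjugation.
Context {K : numFieldType} {W : lmodType K} (L : W -> W) (lin_L : linear L).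
Variables (b : int) (S : nat -> nat -> int -> W) (D : nat -> int -> W).
Hypothesis L_S : forall j k n, L (S j k n) =
  k.+1%:R *: S j k.+1 n + j.+1%:R *: S j.+1 k n
  + (2 * (b - j%:Z) + n - 1)%:~R *: S j k (n - 1).
Hypothesis D0 : forall n, D 0 n = S 0 0 n.
Hypothesis L_D : forall q n, L (D q n) = q.+1%:R *: D q.+1 n.
Local Notation C := (@binomz K).

Let T e a n := diag_sum e (fun i q => ((-1) ^+ i * C a i) *: D q (n - i%:Z)).
Let U e a n := diag_sum3 e
  (fun i j k => C (n + 2 * b - 1 - a - j%:Z) i *: S j k (n - i%:Z)).

Let T_rec e a n :
  e.+1%:R *: T e.+1 a n = L (T e a n) - a%:~R *: T e (a - 1) (n - 1).
Proof.
rewrite diag_sum_weight; congr (_ + _).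
  rewrite /T /diag_sum (lin_sum lin_L); apply: eq_bigr => j _.
  by rewrite (linZ lin_L) L_D !scalerA mulrC.
rewrite -scaleNr -diag_sumZ; apply: eq_diag_sum => i j _.
have -> : n - 1 - i%:Z = n - i.+1%:Z by lia.
rewrite !scalerA mulrCA binomz_absorb exprS; congr (_ *: _); ring.
Qed.

Let U_rec e a n :
  e.+1%:R *: U e.+1 a n = L (U e a n) - a%:~R *: U e (a - 1) (n - 1).
Proof.
(* Shifting j costs a Pascal difference of the binomials, which a shift from j
   to i absorbs (Q below). *)
rewrite diag_sum3_weight; set be := n + 2 * b - 1 - a.
have -> : L (U e a n) = diag_sum3 e (fun i j k => C (be - j%:Z) i *: L (S j k (n - i%:Z))).
  rewrite /U /diag_sum3 /diag_sum (lin_sum lin_L); apply: eq_bigr => k _.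
  by rewrite (lin_sum lin_L); apply: eq_bigr => j _; rewrite (linZ lin_L).
rewrite -scaleNr -diag_sum3Z -[RHS]diag_sum3D.
pose X i j k := j.+1%:R *: (C (be - j.+1%:Z) i *: S j.+1 k (n - i%:Z)).
pose Y i j k := (j.+1%:R * C (be - j%:Z) i) *: S j.+1 k (n - i%:Z).
pose Q i j k := (j%:R * C (be - j%:Z) i) *: S j k (n - i%:Z - 1).
have XYQ : diag_sum3 e X = diag_sum3 e (fun i j k => Y i j k + -1 *: Q i j k).
  rewrite [RHS]diag_sum3D diag_sum3Z scaleN1r; apply/eqP; rewrite eq_sym subr_eq; apply/eqP.
  have -> : diag_sum3 e Y = diag_sum3 e (fun i j k => X i j k + (Y i j k - X i j k)).
    by apply: eq_diag_sum3 => i j k; rewrite addrC subrK.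
  rewrite diag_sum3D; congr (_ + _); apply: eq_diag_sum => a' k _.
  apply: diag_sum_shift => [i j|j|i].
  - rewrite /Y /X /Q scalerA -scalerBl -mulrBr.
    have -> : be - j.+1%:Z = be - j%:Z - 1 by lia.
    by rewrite binomz_pascal; congr (_ *: S _ _ _); lia.
  - by rewrite /Y /X !binomz0 scale1r mulr1 subrr.
  - by rewrite /Q mul0r scale0r.
rewrite [Z in _ + Z + _ = _]XYQ -!diag_sum3D; apply: eq_diag_sum3 => i j k.
rewrite /Y /Q L_S.
have -> : n - 1 - i%:Z = n - i%:Z - 1 by lia.
have -> : n - i.+1%:Z = n - i%:Z - 1 by lia.
have -> : n - 1 + 2 * b - 1 - (a - 1) - j%:Z = be - j%:Z by rewrite /be; lia.
rewrite !scalerDr !scalerA binomzS !rmorphB /= -!addrA.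
congr (_ *: _ + (_ *: _ + _)); [ring|ring|].
rewrite -!scalerDl; congr (_ *: _).
set c := binomz _ i; rewrite /be; ring.
Qed.

Lemma conjugation e a n :
  diag_sum3 e (fun i j k => C (n + 2 * b - 1 - a - j%:Z) i *: S j k (n - i%:Z))
  = diag_sum e (fun i q => ((-1) ^+ i * C a i) *: D q (n - i%:Z)).
Proof.
elim: e a n => [|e IH] a n.
  by rewrite /diag_sum3 !diag_sum0 !binomz0 expr0 mulr1 D0.
apply: (@scalerI _ _ e.+1%:R); first by rewrite pnatr_eq0.
have := U_rec e a n; have := T_rec e a n; rewrite /T /U => -> ->.
congr (L _ - _ *: _); first exact: IH.
rewrite -IH; apply: eq_diag_sum3 => i j k; congr (C _ _ *: _); lia.
Qed.

End Conjugation.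

(** * The Jacobi identity as Borcherds' identity *)

Section JacobiCoefficients.
Local Open Scope classical_set_scope.
Context {K : numFieldType} {V M : lmodType K}.
Context (DV : int -> {linear V -> (V ⊗ V)%type}).
Context (DM : int -> {linear M -> (V ⊗ M)%type}).
Hypothesis truncM : truncated DM.
Local Notation C := (@binomz K).

Lemma zcoef_linear n : linear (zcoef DM n).
Proof. by move=> a x y; rewrite /zcoef linearP. Qed.

Lemma zcoef_trunc m : exists N : int, forall n, N <= n -> zcoef DM n m = 0.
Proof.
have [N N0] := truncM m; exists (- N) => n nN; apply: N0; lia.
Qed.

(** In each of the three products of series the exponent of z0 (or of z1) and the
    homogeneity of the binomial leave one free index j, the exponent of the
    expanded variable, and truncation on m bounds it. *)
Lemma jacobi_sums m (n0 n1 n2 : int) (N := - n0 - 1) : \forall J \near \oo,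
  [/\ fsmul delta_12_0 (comp_12 DM m) (mk_expo3 n0 n1 n2) =
        \sum_(j < J) ((-1) ^+ j * C N j) *:
          tassoc (tmap id (zcoef DM (n2 - j%:Z)) (zcoef DM (n1 - N + j%:Z) m)),
      fsmul delta_21_0 (comp_21 DM m) (mk_expo3 n0 n1 n2) =
        (-1) ^ N *: \sum_(j < J) ((-1) ^+ j * C N j) *:
          tmap tswap id (tassoc (tmap id (zcoef DM (n1 - j%:Z))
            (zcoef DM (n2 - N + j%:Z) m)))
    & fsmul delta_20_1 (comp_02 DV DM m) (mk_expo3 n0 n1 n2) =
        \sum_(j < J) C (- n1 - 1) j *:
          tmap (zcoef DV (n0 - j%:Z)) id (zcoef DM (n2 + n1 + 1 + j%:Z) m)].
Proof.
have [B B0] := zcoef_trunc m.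
have lid := tmap_linear (@id_linear K V) (zcoef_linear _).
have las := @tassoc_linear K V V M.
have lsw := tmap_linear (@tswap_linear K V V) (@id_linear K M).
exists (absz (B - n1 + N)%R + absz (B - n2 + N)%R + absz (B - n2 - n1 - 1)%R)%N => // J /= hJ.
split.
- rewrite /fsmul (fsum_inj (e := fun j => mk_expo3 n0 (N - j%:Z) j%:Z) (J := J)).
  + apply: eq_bigr => j _; rewrite /= -/N subrK eqxx subrr eqxx.
    by congr (_ *: tassoc (tmap _ _ (zcoef _ _ _))); lia.
  + by move=> j k [] _ [].
  move=> [[i0 i1] [j|j]] ni /=; last by rewrite scale0r.
  case: eqP => [ij|_]; last by rewrite scale0r.
  case: eqP => [n0i|_]; last by rewrite scaler0.
  have jJ : (J <= j)%N.
    rewrite leqNgt; apply/negP => /ni; apply.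
    by rewrite /mk_expo3; congr (_, _, _); lia.
  by rewrite B0 ?(lin0 (lid _)) ?(lin0 las) ?scaler0 //; lia.
- rewrite /fsmul (fsum_inj (e := fun j => mk_expo3 n0 j%:Z (N - j%:Z)) (J := J)).
  + rewrite scaler_sumr; apply: eq_bigr => j _; rewrite /= -/N subrK eqxx subrr eqxx.
    rewrite scalerA; congr (_ *: tmap _ _ (tassoc (tmap _ _ (zcoef _ _ _)))); lia.
  + by move=> j k [] [].
  move=> [[i0 [j|j]] i2] ni /=; last by rewrite mulr0 scale0r.
  case: eqP => [ij|_]; last by rewrite mulr0 scale0r.
  case: eqP => [n0i|_]; last by rewrite scaler0.
  have jJ : (J <= j)%N.
    rewrite leqNgt; apply/negP => /ni; apply.
    by rewrite /mk_expo3; congr (_, _, _); lia.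
  by rewrite B0 ?(lin0 (lid _)) ?(lin0 las) ?(lin0 lsw) ?scaler0 //; lia.
- rewrite /fsmul (fsum_inj (e := fun j => mk_expo3 j%:Z n1 (- n1 - 1 - j%:Z)) (J := J)).
  + apply: eq_bigr => j _; rewrite /= subrK eqxx subrr eqxx expr1n mul1r.
    by congr (_ *: tmap _ _ (zcoef _ _ _)); lia.
  + by move=> j k [] [].
  move=> [[[j|j] i1] i2] ni /=; last by rewrite scale0r.
  case: eqP => [ij|_]; last by rewrite scale0r.
  case: eqP => [n0i|_]; last by rewrite scaler0.
  have jJ : (J <= j)%N.
    rewrite leqNgt; apply/negP => /ni; apply.
    by rewrite /mk_expo3; congr (_, _, _); lia.
  have lDV : linear (zcoef DV (n0 - j%:Z)) by move=> a x y; rewrite /zcoef linearP.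
  rewrite B0 ?(lin0 (tmap_linear _ _)) ?scaler0 //; lia.
Qed.

Definition form_product (f g : V -> K^o) (n : int) (v : V) : K^o :=
  tpair f g (zcoef DV n v).

Lemma form_product_linear f g n : linear f -> linear g -> linear (form_product f g n).
Proof.
move=> lf lg; apply: comp_linear (tpair_linear lf lg).
by move=> a x y; rewrite /zcoef linearP.
Qed.

Definition borcherds_lhs (act : (V -> K^o) -> int -> M -> M) (f g : V -> K^o)
    (n0 n1 n2 : int) (m : M) (J : nat) : M :=
  let N := - n0 - 1 in
  \sum_(j < J) ((-1) ^+ j * C N j) *: act g (n2 - j%:Z) (act f (n1 - N + j%:Z) m)
  - (-1) ^ N *: \sum_(j < J) ((-1) ^+ j * C N j) *:
      act f (n1 - j%:Z) (act g (n2 - N + j%:Z) m).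

Definition borcherds_rhs (act : (V -> K^o) -> int -> M -> M) (f g : V -> K^o)
    (n0 n1 n2 : int) (m : M) (J : nat) : M :=
  \sum_(j < J) C (- n1 - 1) j *:
      act (form_product f g (n0 - j%:Z)) (n2 + n1 + 1 + j%:Z) m.

Let actM (f : V -> K^o) (n : int) (m : M) : M := tforml f (zcoef DM n m).

Let pairE (f g : V -> K^o) (n0 n1 n2 : int) (m : M) (N := - n0 - 1) J :
  linear f -> linear g ->
  [/\ tforml (tpair f g) (\sum_(j < J) ((-1) ^+ j * C N j) *:
          tassoc (tmap id (zcoef DM (n2 - j%:Z)) (zcoef DM (n1 - N + j%:Z) m))) =
      \sum_(j < J) ((-1) ^+ j * C N j) *: actM g (n2 - j%:Z) (actM f (n1 - N + j%:Z) m),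
     tforml (tpair f g) ((-1) ^ N *: \sum_(j < J) ((-1) ^+ j * C N j) *:
          tmap tswap id (tassoc (tmap id (zcoef DM (n1 - j%:Z))
            (zcoef DM (n2 - N + j%:Z) m)))) =
      (-1) ^ N *: \sum_(j < J) ((-1) ^+ j * C N j) *:
      actM f (n1 - j%:Z) (actM g (n2 - N + j%:Z) m)
    & tforml (tpair f g) (\sum_(j < J) C (- n1 - 1) j *:
          tmap (zcoef DV (n0 - j%:Z)) id (zcoef DM (n2 + n1 + 1 + j%:Z) m)) =
      \sum_(j < J) C (- n1 - 1) j *:
      actM (form_product f g (n0 - j%:Z)) (n2 + n1 + 1 + j%:Z) m].
Proof.
move=> lf lg; have lfg := tpair_linear lf lg; have lt := @tforml_linear K _ M _ lfg.
have lM n := zcoef_linear n.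
have lV n : linear (zcoef DV n) by move=> a x y; rewrite /zcoef linearP.
split.
- rewrite (lin_sum lt); apply: eq_bigr => j _; rewrite (linZ lt) tforml_tassoc //.
  by rewrite (tforml_tmap (W := M) (W' := (V ⊗ M)%type)).
- rewrite (linZ lt) (lin_sum lt); congr (_ *: _); apply: eq_bigr => j _.
  rewrite (linZ lt) (tforml_tmap (W := M) (W' := M)) //; last exact: tswap_linear.
  have -> : (fun v => tpair f g (tswap v)) = tpair g f.
    by apply: funext => x; rewrite tpair_tswap.
  by rewrite tforml_tassoc // (tforml_tmap (W := M) (W' := (V ⊗ M)%type)).
- rewrite (lin_sum lt); apply: eq_bigr => j _; rewrite (linZ lt).
  by rewrite (tforml_tmap (W := M) (W' := M)).
Qed.

(** Paired with two forms on V, the Jacobi identity becomes Borcherds' identity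
    between the operators (f ⊗ Id) Υ(z); all sums are finite, by truncation. *)
Lemma jacobi_borcherds (f g : V -> K^o) n0 n1 n2 m : linear f -> linear g ->
  jacobi DV DM -> \forall J \near \oo,
    borcherds_lhs actM f g n0 n1 n2 m J = borcherds_rhs actM f g n0 n1 n2 m J.
Proof.
move=> lf lg jac; have lt := @tforml_linear K _ M _ (tpair_linear lf lg).
have [J1 _ H1] := jacobi_sums m n0 n1 n2; exists J1 => // J /H1[e1 e2 e3].
have [p1 p2 p3] := pairE n0 n1 n2 m J lf lg.
rewrite /borcherds_lhs /borcherds_rhs -p1 -p2 -p3 -(linB lt).
by move: (jac m (mk_expo3 n0 n1 n2)); rewrite e1 e2 e3 => ->.
Qed.

(** Conversely it is enough to test the identity with forms that separate
    points, on M as well: the number of terms to sum may then depend on the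
    form on M. *)
Lemma borcherds_jacobi (F : set (V -> K^o)) (G : set (M -> K^o)) :
  separating F -> separating G ->
  (forall f g h, F f -> F g -> G h -> forall n0 n1 n2 m, \forall J \near \oo,
    h (borcherds_lhs actM f g n0 n1 n2 m J) = h (borcherds_rhs actM f g n0 n1 n2 m J)) ->
  jacobi DV DM.
Proof.
move=> sepF sepG bor m [[n0 n1] n2]; have linF := sepF.1.
apply/eqP; rewrite -subr_eq0; apply/eqP.
have sep2 : separating [set h : (V ⊗ V)%type -> K^o |
    exists f g, [/\ F f, F g & h = tpair f g]].
  split=> [_ [f [g [Ff Fg ->]]]|x x0]; first by apply: tpair_linear; exact: linF.
  apply: (tens_separate sepF) => f Ff; apply: sepF.2 => g Fg.
  have := x0 (tpair f g); rewrite tpair_tforml; [|exact: linF|exact: linF].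
  by apply; exists f, g.
apply: (tens_separate sep2) => _ [f [g [Ff Fg ->]]].
have lf := linF f Ff; have lg := linF g Fg.
have lt := @tforml_linear K _ M _ (tpair_linear lf lg).
apply: sepG.2 => h Gh.
have [J1 _ H1] := jacobi_sums m n0 n1 n2.
have [J2 _ H2] := bor f g h Ff Fg Gh n0 n1 n2 m; pose J := maxn J1 J2.
have [p1 p2 p3] := pairE n0 n1 n2 m J lf lg.
have [e1 e2 e3] := H1 J (leq_maxl _ _); have b := H2 J (leq_maxr _ _).
rewrite -[(n0, n1, n2)]/(mk_expo3 n0 n1 n2) e1 e2 e3 !(linB lt) p1 p2 p3.
by rewrite (linB (sepG.1 h Gh)); apply/eqP; rewrite subr_eq0; apply/eqP.
Qed.

End JacobiCoefficients.

(** * The algebra of forms on a vertex operator coalgebra *)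

Section FormAction.
Local Open Scope classical_set_scope.
Context {K : fieldType} {I : choiceType} {V M : lmodType K} {gV : I -> set V}.
Variable D : int -> M -> V ⊗ M.

Definition act (f : gdual gV) (n : int) (m : M) : M := tforml f (zcoef D n m).

Lemma tforml_linear_form (x : V ⊗ M) : linear (fun f : gdual gV => tforml f x).
Proof.
move=> a f g; have l (h : gdual gV) := @tforml_linear K V M h (gdual_linear h).
apply: (tens_ext (f := tforml (a *: f + g)) (g := fun x => a *: tforml f x + tforml g x)).
- exact: l.
- move=> b y z; rewrite !l !scalerDr !scalerA [b * a]mulrC -!addrA; congr (_ + _).
  by rewrite addrCA.
- move=> v m; rewrite !(tformlE _ _ (gdual_linear _)) scalerA -scalerDl.
  by congr (_ *: m); exact: ev_linear.
Qed.

Lemma act_linear_form n m : linear (fun f => act f n m).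
Proof. exact: tforml_linear_form. Qed.

Lemma act_linear f n : linear (zcoef D n) -> linear (act f n).
Proof. by move=> lD; apply: comp_linear lD (tforml_linear (gdual_linear f)). Qed.

End FormAction.

Section VertexCoalgebra.
Local Open Scope classical_set_scope.
Context {K : numFieldType} {V : lmodType K} {gV : int -> set V}.
Context {DV : int -> {linear V -> (V ⊗ V)%type}} {c rho : {linear V -> K^o}} {d : K}.
Hypothesis HV : graded_voc gV DV c rho d.
Hypothesis Hrho : forall (s : int) (v : V), s <> 2 -> gV s v -> rho v = 0.
Local Notation V' := (gdual gV).
Local Notation hom := (gdual_part (G := gV)).
Local Notation LV := (Lop rho DV).
Implicit Types (f g : V') (n k : int) (v : V).

Let gradV := voc_graded HV.
Let finV := voc_finite HV.

Lemma zcoefV_linear n : linear (zcoef DV n).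
Proof. by move=> a x y; rewrite /zcoef linearP. Qed.

Lemma zcoefV_span n s v : gV s v ->
  lspan [set x | exists a b u w, [/\ a + b = s - n, gV a u, gV b w & x = u ⊗ w]]
    (zcoef DV n v).
Proof. by move=> /(voc_degree HV (- n - 1)); rewrite -addrA subrK. Qed.

Lemma form_product_eq0 (f g : V -> K^o) n s v : linear f -> linear g -> gV s v ->
  (forall a b u w, a + b = s - n -> gV a u -> gV b w -> f u = 0 \/ g w = 0) ->
  form_product DV f g n v = 0.
Proof.
move=> lf lg Gv fg0; have lfg := tpair_linear lf lg.
apply: (lspan_min (subspace_ker lfg)) (zcoefV_span n Gv).
move=> _ [a [b [u [w [e Gu Gw ->]]]]] /=; rewrite tpairE //.
by case: (fg0 a b u w e Gu Gw) => ->; rewrite ?mul0r ?mulr0.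
Qed.

Lemma form_product_finite f g n :
  finite_set [set s | exists2 v, gV s v & form_product DV f g n v != 0].
Proof.
have := finite_image2 (fun a b => a + b + n) (gdual_finite f) (gdual_finite g).
apply: sub_finite_set => s [v Gv]; apply: contra_neqP => nv.
apply: form_product_eq0 (gdual_linear f) (gdual_linear g) Gv _ => a b u w e Gu Gw.
apply: contrapT => /not_orP[/eqP fu /eqP gw]; apply: nv.
exists a; first by exists u.
exists b; first by exists w.
lia.
Qed.

(** The coefficient of z^n of the product of f and g in the vertex operator
    algebra V'. *)
Definition star n f g : V' :=
  form_gdual (form_product_linear DV n (gdual_linear f) (gdual_linear g))
    (form_product_finite f g n).

Lemma starE n f g v : star n f g v = g (act DV f n v).
Proof. by rewrite /act -tpair_tforml //; exact: gdual_linear. Qed.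

Lemma star_linear_l n g : linear ((star n)^~ g).
Proof.
move=> a f f'; apply: gdual_ext => v; rewrite [RHS]ev_linear !starE.
by rewrite act_linear_form (gdual_linear g).
Qed.

Lemma star_linear_r n f : linear (star n f).
Proof.
by move=> a g g'; apply: gdual_ext => v; rewrite [RHS]ev_linear !starE ev_linear.
Qed.

Lemma hom_star a b n f g : hom a f -> hom b g -> hom (a + b + n) (star n f g).
Proof.
move=> fa gb s v ns Gv; apply: form_product_eq0 (gdual_linear f) (gdual_linear g) Gv _.
move=> a' b' u w e Gu Gw; have [aa|na] := eqVneq a' a; last first.
  by left; apply: fa Gu; exact/eqP.
by right; apply: gb Gw => bb; apply: ns; lia.
Qed.

Definition rho_form : V' :=
  form_gdual (linearP rho : linear (rho : V -> K^o)) (homogeneous_finite Hrho).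

Lemma hom_rho : hom 2 rho_form.
Proof. exact: Hrho. Qed.

Lemma act_rho (M : lmodType K) (D : int -> M -> V ⊗ M) n m :
  act D rho_form n m = Lop rho D (n + 2) m.
Proof. by rewrite /Lop addrK. Qed.

(** The counit is concentrated in degree 0: by the left counit axiom its
    component of degree s, applied to the left factor of Υ(z)v, extracts a
    component of v, which the right counit axiom identifies with c(v). *)
Lemma counit_degree s v : s <> 0 -> gV s v -> c v = 0.
Proof.
move=> ns Gv; have lc : linear (c : V -> K^o) := linearP c.
have lcs : linear (fun v => c (hcomp gV s v) : K^o).
  exact: comp_linear (hcomp_linear gradV s) lc.
have e1 : tforml (fun v => c (hcomp gV s v)) (zcoef DV 0 v) =
          hcomp gV 0 (tforml c (zcoef DV 0 v)).
  have l1 := @tforml_linear K V V _ lcs.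
  have l2 := comp_linear (@tforml_linear K V V _ lc) (hcomp_linear gradV 0).
  apply: (lspan_min (subspace_eq l1 l2)) (zcoefV_span 0 Gv).
  move=> _ [a [b [u [w [e Gu Gw ->]]]]] /=; rewrite !tformlE //.
  rewrite (linZ (hcomp_linear gradV 0)) (hcomp_id gradV _ Gu) (hcomp_id gradV _ Gw).
  have -> : (0 == b) = (s == a) by apply/eqP/eqP; lia.
  by case: eqP => // _; rewrite (lin0 lc) scale0r scaler0.
have vE : tformr c (zcoef DV 0 v) = v by rewrite (voc_counit_right HV) ?eqxx.
transitivity (c (hcomp gV s (tformr c (zcoef DV 0 v)))).
  by rewrite vE (hcomp_id gradV _ Gv) eqxx.
rewrite -(tpair_tformr _ lcs lc) tpair_tforml // e1 (voc_counit_left HV) eqxx.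
by rewrite (hcomp_id gradV _ Gv); case: eqP => [e0|_]; [case: ns|rewrite (lin0 lc)].
Qed.

Definition counit_form : V' :=
  form_gdual (linearP c : linear (c : V -> K^o)) (homogeneous_finite counit_degree).

Lemma hom_counit : hom 0 counit_form.
Proof. exact: counit_degree. Qed.

Lemma LV_linear k : linear (LV k).
Proof.
by apply: comp_linear (zcoefV_linear _) (tforml_linear _); exact: linearP.
Qed.

Lemma star_rho n f v : star n rho_form f v = f (LV (n + 2) v).
Proof. by rewrite starE act_rho. Qed.

Lemma hom_L0 a f : hom a f -> star (- 2) rho_form f = a%:~R *: f.
Proof.
move=> fa; apply: (gdual_ext_hom gradV) => s v Gv.
rewrite star_rho [RHS](linZ (ev_linear v)).
have /= -> : LV (- 2 + 2) v = s%:~R *: v by move: Gv; rewrite (voc_eigenspace HV).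
rewrite (linZ (gdual_linear f)); have [->//|/eqP sa] := eqVneq s a.
by rewrite (fa s v sa Gv) !scaler0.
Qed.

(** The transpose of L(-1), as L(-1) is the coefficient of z^-3 in
    (ρ ⊗ Id) Υ(z). *)
Definition Ldual f : V' := star (- 3) rho_form f.

Lemma Ldual_linear : linear Ldual.
Proof. exact: star_linear_r. Qed.

Lemma hom_Ldual a f : hom a f -> hom (a - 1) (Ldual f).
Proof. by move=> fa; have := hom_star (n := - 3) hom_rho fa; congr hom; lia. Qed.

Definition divided_power (q : nat) f : V' := (q`!%:R)^-1 *: iter q Ldual f.
Local Notation dpow := divided_power.

Lemma dpow0 f : dpow 0 f = f.
Proof. by rewrite /divided_power fact0 invr1 scale1r. Qed.

Lemma Ldual_dpow q f : Ldual (dpow q f) = q.+1%:R *: dpow q.+1 f.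
Proof.
rewrite /divided_power (linZ Ldual_linear) iterS scalerA factS natrM invfM mulrA divff ?mul1r //.
by rewrite pnatr_eq0.
Qed.

Lemma dpow_linear q : linear (dpow q).
Proof.
elim: q => [|q IH] a f g; first by rewrite !dpow0.
apply: (@scalerI _ _ q.+1%:R); first by rewrite pnatr_eq0.
by rewrite -Ldual_dpow IH Ldual_linear !Ldual_dpow scalerDr !scalerA [a * _]mulrC.
Qed.

Lemma hom_dpow a q f : hom a f -> hom (a - q%:Z) (dpow q f).
Proof.
move=> fa; elim: q => [|q IH]; first by rewrite dpow0 subr0.
have -> : dpow q.+1 f = (q.+1%:R)^-1 *: Ldual (dpow q f).
  by rewrite Ldual_dpow scalerA mulVf ?scale1r // pnatr_eq0.
apply: subspace_scale (gdual_part_subspace _) _.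
by have := hom_Ldual IH; congr hom; lia.
Qed.

(** The right counit axiom, read on the ρ-component of Υ: c is the vacuum of the
    algebra of forms and ρ = c ∘ L(2) its conformal vector. *)
Lemma counit_L k v : k <= 2 -> c (LV k v) = if k == 2 then rho v else 0.
Proof.
move=> k2; rewrite /Lop -tpair_tforml; [|exact: linearP|exact: linearP].
rewrite tpair_tformr; [|exact: linearP|exact: linearP].
rewrite (voc_counit_right HV); last by lia.
by rewrite subr_eq0; case: eqP => // _; rewrite linear0.
Qed.

Lemma Ldual_counit : Ldual counit_form = 0.
Proof.
by apply: gdual_ext => v; rewrite star_rho [LHS]counit_L // (lin0 (ev_linear v)).
Qed.

(** As ρ = c ∘ L(2) and [L(2), L(-1)] = 3 L(1), the form ρ ∘ L(-1) is a
    combination of c ∘ L(-1) ∘ L(2) and c ∘ L(1), which both vanish. *)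
Lemma Ldual_rho : Ldual rho_form = 0.
Proof.
apply: gdual_ext => v; rewrite star_rho (lin0 (ev_linear v)) /=.
have e1 := counit_L (LV (- 1) v) (lexx 2); rewrite eqxx in e1.
have e2 : c (LV (- 1) (LV 2 v)) = 0 by rewrite counit_L.
have e3 : c (LV 1 v) = 0 by rewrite counit_L.
have := congr1 c (voc_virasoro HV 2 (- 1) v); rewrite /= scale0r addr0.
by rewrite linearB linearZ_LR /= e1 e2 e3 subr0 scaler0.
Qed.

Variable lowest : int.
Hypothesis bounded : forall s, s < lowest -> gV s = [set 0].

(** With [hom_dpow], this makes the transpose of L(-1) locally nilpotent. *)
Lemma hom_lowest a f : hom a f -> a < lowest -> f = 0.
Proof.
move=> fa al; apply: (gdual_ext_hom gradV) => s v Gv; rewrite (lin0 (ev_linear v)).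
have [sa|/eqP sa] := eqVneq s a; last exact: fa Gv.
by move: Gv; rewrite bounded ?sa // => ->; rewrite (lin0 (gdual_linear f)).
Qed.

End VertexCoalgebra.

(** * Commutators *)

Section Commutators.
Local Open Scope classical_set_scope.
Context {K : numFieldType} {V : lmodType K} {gV : int -> set V}.
Context {DV : int -> {linear V -> (V ⊗ V)%type}} {c rho : {linear V -> K^o}} {d : K}.
Hypothesis HV : graded_voc gV DV c rho d.
Hypothesis Hrho : forall (s : int) (v : V), s <> 2 -> gV s v -> rho v = 0.
Local Notation V' := (gdual gV).
Local Notation hom := (gdual_part (G := gV)).
Local Notation LV := (Lop rho DV).
Local Notation C := (@binomz K).
Local Notation star := (star HV).
Local Notation rho_form := (rho_form Hrho).
Local Notation Ldual := (Ldual HV Hrho).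
Implicit Types (f g : V') (n a b : int).

Section Comodule.
Context {M : lmodType K} {DM : int -> {linear M -> (V ⊗ M)%type}}.
Hypothesis truncM : truncated DM.
Hypothesis jacobiM : jacobi DV DM.
Local Notation act := (act DM).

Lemma actM_linear f n : linear (act f n).
Proof. by apply: act_linear => a x y; rewrite /zcoef linearP. Qed.

Lemma borcherds_act f g n0 n1 n2 m (N := - n0 - 1) : \forall J \near \oo,
  \sum_(j < J) ((-1) ^+ j * C N j) *: act g (n2 - j%:Z) (act f (n1 - N + j%:Z) m)
  - (-1) ^ N *: \sum_(j < J) ((-1) ^+ j * C N j) *:
      act f (n1 - j%:Z) (act g (n2 - N + j%:Z) m)
  = \sum_(j < J) C (- n1 - 1) j *: act (star (n0 - j%:Z) f g) (n2 + n1 + 1 + j%:Z) m.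
Proof.
exact: (jacobi_borcherds truncM n0 n1 n2 m (gdual_linear f) (gdual_linear g) jacobiM).
Qed.

(** Borcherds' identity at n0 = -1, where the binomial of the left hand side is
    constant, and n1 = -p-1, where that of the right hand side is a
    polynomial. *)
Lemma commutator f g (p : nat) n m :
  act g n (act f (- p%:Z - 1) m) - act f (- p%:Z - 1) (act g n m) =
  \sum_(j < p.+1) C p j *: act (star (- 1 - j%:Z) f g) (n - p%:Z + j%:Z) m.
Proof.
have [J0 _ H] := borcherds_act f g (- 1) (- p%:Z - 1) n m.
have := H (maxn J0 p.+1) (leq_maxl _ _); set J := maxn _ _.
have pJ : (p.+1 <= J)%N by exact: leq_maxr.
have J1 : (1 <= J)%N by exact: leq_trans pJ.
have sum1 (F : nat -> M) : \sum_(j < J) ((-1) ^+ j * C 0 j) *: F j = F 0%N.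
  rewrite (sum_truncate (F := fun j => ((-1) ^+ j * C 0 j) *: F j) J1) => [|j j1].
    by rewrite big_ord1 binomz0 expr0 mulr1 scale1r.
  by rewrite binomz_small // mulr0 scale0r.
have -> : - (- 1) - 1 = 0 :> int by [].
have -> : - (- p%:Z - 1) - 1 = p%:Z by lia.
rewrite (sum1 (fun j => act g (n - j%:Z) (act f (- p%:Z - 1 - 0 + j%:Z) m))).
rewrite (sum1 (fun j => act f (- p%:Z - 1 - j%:Z) (act g (n - 0 + j%:Z) m))).
rewrite (sum_truncate (F := fun j => C p j *:
  act (star (- 1 - j%:Z) f g) (n + (- p%:Z - 1) + 1 + j%:Z) m) pJ) => [|j pj]; last first.
  by rewrite binomz_small // scale0r.
have p0 (x : int) : x + 0%N%:Z = x by exact: addr0.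
have m0 (x : int) : x - 0%N%:Z = x by exact: subr0.
rewrite ?(p0, m0, subr0, addr0) expr0z scale1r => ->; apply: eq_bigr => j _.
by congr (C _ _ *: act _ _ _); lia.
Qed.

Hypothesis L1M : forall m n,
  tmap (LV 1) id (zcoef DM n m) = (n + 1)%:~R *: zcoef DM (n + 1) m.

Lemma act_L1 f n m : act (star (- 1) rho_form f) n m = (n + 1)%:~R *: act f (n + 1) m.
Proof.
rewrite -(linZ (tforml_linear (gdual_linear f))) -L1M.
rewrite (tforml_tmap (W := M) (W' := M)) //; [|exact: LV_linear|exact: gdual_linear].
congr (tforml _ _); apply: funext => v; exact: (star_rho HV Hrho (- 1) f v).
Qed.

(** The commutator with ρ at p = 2.  The three terms of the sum are the forms
    f ∘ L(1), f ∘ L(0) and f ∘ L(-1): the first is a derivative of Υ, the second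
    a multiple of f. *)
Lemma L_commutator a f n m : hom a f ->
  act f n (Lop rho DM (- 1) m) - Lop rho DM (- 1) (act f n m) =
  (2 * a + n - 1)%:~R *: act f (n - 1) m + act (Ldual f) n m.
Proof.
move=> fa; have := commutator rho_form f 2 n m.
rewrite !(act_rho Hrho) /= => ->.
rewrite !big_ord_recr big_ord0 /= add0r binomz0 scale1r.
have -> : C 2 1 = 2.
  have := binomzS (K := K) 2 0; rewrite binomz0 mul1r mulr1 => ->; ring.
have -> : C 2 2 = 1.
  have := binomz_absorb (K := K) 2 1; rewrite -[2 - 1]/(1%:Z) => e.
  apply: (@mulfI _ 2); first by rewrite pnatr_eq0.
  rewrite e; have := binomzS (K := K) 1 0; rewrite binomz0 mul1r mulr1 => ->; ring.
rewrite scale1r subr0 act_L1 (hom_L0 HV Hrho fa).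
rewrite (linZ (act_linear_form _ _ _)) !addr0.
have -> : n - 2%:Z + 1 = n - 1 by lia.
rewrite subrK scalerA -scalerDl; congr (_ *: _ + _); ring.
Qed.

End Comodule.
End Commutators.

(** * Borcherds' identity for the adjoint operators *)

Section AdjointAction.
Local Open Scope classical_set_scope.
Context {K : numFieldType} {V : lmodType K} {gV : int -> set V}.
Context {DV : int -> {linear V -> (V ⊗ V)%type}} {c rho : {linear V -> K^o}} {d : K}.
Hypothesis HV : graded_voc gV DV c rho d.
Hypothesis Hrho : forall (s : int) (v : V), s <> 2 -> gV s v -> rho v = 0.
Variable lowest : int.
Hypothesis bounded : forall s, s < lowest -> gV s = [set 0].
Local Notation V' := (gdual gV).
Local Notation hom := (gdual_part (G := gV)).
Local Notation LV := (Lop rho DV).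
Local Notation C := (@binomz K).
Local Notation star := (star HV).
Local Notation rho_form := (rho_form Hrho).
Local Notation Ldual := (Ldual HV Hrho).
Local Notation dpow := (divided_power HV Hrho).
Implicit Types (f g : V') (n a b : int).

Lemma Ldual_star a f g n : hom a f -> Ldual (star n f g) =
  star n f (Ldual g) + star n (Ldual f) g + (2 * a + n - 1)%:~R *: star (n - 1) f g.
Proof.
move=> fa; apply: gdual_ext => v.
have LE h u : Ldual h u = h (LV (- 1) u) by exact: star_rho.
have e : act DV f n (LV (- 1) v) - LV (- 1) (act DV f n v) =
    (2 * a + n - 1)%:~R *: act DV f (n - 1) v + act DV (Ldual f) n v.
  apply: (L_commutator HV Hrho (voc_truncated HV) (voc_jacobi HV) _ _ _ fa).
  by move=> u k; exact: (voc_L1 HV u k).1.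
rewrite !(linD (ev_linear v)) (linZ (ev_linear v)) LE (starE HV n f g).
rewrite (starE HV n f (Ldual g)) (starE HV n (Ldual f)) (starE HV (n - 1)).
rewrite (LE g) -(linZ (gdual_linear g)) -!(linD (gdual_linear g)).
by congr (g _); rewrite -addrA [X in _ + X]addrC -e addrC subrK.
Qed.

Lemma star_dpow e f g n0 a alpha : hom a f ->
  diag_sum3 e (fun i j k => C (n0 + 2 * a - 1 - alpha - j%:Z) i *:
    star (n0 - i%:Z) (dpow j f) (dpow k g)) =
  diag_sum e (fun i q => ((-1) ^+ i * C alpha i) *: dpow q (star (n0 - i%:Z) f g)).
Proof.
move=> fa.
apply: (conjugation (S := fun j k n => star n (dpow j f) (dpow k g))
  (D := fun q n => dpow q (star n f g)) (Ldual_linear HV Hrho)).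
- move=> j k n; rewrite (Ldual_star _ _ (hom_dpow HV Hrho (q := j) fa)).
  rewrite !Ldual_dpow (linZ (star_linear_r HV n (dpow j f)) _ (dpow k.+1 g)).
  by rewrite (linZ (star_linear_l HV n (dpow k g)) _ (dpow j.+1 f)).
- by move=> n; rewrite !dpow0.
- by move=> q n; rewrite Ldual_dpow.
Qed.

Lemma dpow_lowest a f q : hom a f -> a - q%:Z < lowest -> dpow q f = 0.
Proof.
by move=> /(hom_dpow HV Hrho (q := q)) fa; apply: (hom_lowest HV bounded fa).
Qed.

Section Comodule.
Context {M : lmodType K} {DM : int -> {linear M -> (V ⊗ M)%type}}.
Local Notation act := (act DM).

(** The transpose of the coefficient of z^n in (f ⊗ Id) Υ'(z), for f of degree a.
    The bound on q is where the divided powers of f fall below the lowest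
    degree of V. *)
Definition adjoint_act a f n m : M := (-1) ^ a *:
  \sum_(q < (absz (a - lowest)).+1) act (dpow q f) (q%:Z - 2 * a - n) m.

Local Notation aop := adjoint_act.

Lemma aopE a f n m Q : hom a f -> a - Q%:Z < lowest ->
  aop a f n m = (-1) ^ a *: \sum_(q < Q) act (dpow q f) (q%:Z - 2 * a - n) m.
Proof.
move=> fa aQ; rewrite /adjoint_act; congr (_ *: _).
pose F (q : nat) := act (dpow q f) (q%:Z - 2 * a - n) m.
have F0 q : a - q%:Z < lowest -> F q = 0.
  by move=> aq; rewrite /F (dpow_lowest fa aq) (lin0 (act_linear_form _ _ _)).
have [QQ|/ltnW QQ] := leqP Q (absz (a - lowest)).+1.
  by rewrite (sum_truncate (F := F) QQ) // => q Qq; apply: F0; lia.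
by rewrite [RHS](sum_truncate (F := F) QQ) // => q Qq; apply: F0; lia.
Qed.

Lemma aop_linear a f n : linear (aop a f n).
Proof.
move=> x u v; rewrite /adjoint_act.
under eq_bigr => q _ do rewrite (actM_linear _ _ x u v).
by rewrite big_split -scaler_sumr /= scalerDr !scalerA [_ * x]mulrC.
Qed.

Hypothesis truncM : truncated DM.
Hypothesis jacobiM : jacobi DV DM.

(** Both products on the left expand over divided powers of f and of g into
    instances of Borcherds' identity for M, with the two orders exchanged;
    the sums of the right hand sides are compared by [star_dpow]. *)
Lemma aop_borcherds a b f g n0 n1 n2 m (N := - n0 - 1) : hom a f -> hom b g ->
  \forall J \near \oo,
  \sum_(j < J) ((-1) ^+ j * C N j) *:
     aop a f (n1 - N + j%:Z) (aop b g (n2 - j%:Z) m)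
  - (-1) ^ N *: \sum_(j < J) ((-1) ^+ j * C N j) *:
      aop b g (n2 - N + j%:Z) (aop a f (n1 - j%:Z) m)
  = \sum_(j < J) C (- n1 - 1) j *:
      aop (a + b + (n0 - j%:Z)) (star (n0 - j%:Z) f g) (n2 + n1 + 1 + j%:Z) m.
Proof.
move=> fa gb.
(* From total order E on, all forms that occur are below the lowest degree. *)
pose E := (absz (a + b + n0 - lowest)%R + absz (a - lowest)%R + absz (b - lowest)%R).+1.
(* The exponents of the instance for the j-th and k-th divided powers: inverting
   z1 and z2 and clearing the powers of z that the twist brings in. *)
pose n1' (j : nat) := j%:Z - 2 * a - n1 + N.
pose n2' (k : nat) := k%:Z - 2 * b - n2 + N.
pose B1 J (j k : nat) := \sum_(i < J) ((-1) ^+ i * C N i) *: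
  act (dpow k g) (n2' k - i%:Z) (act (dpow j f) (n1' j - N + i%:Z) m).
pose B2 J (j k : nat) := \sum_(i < J) ((-1) ^+ i * C N i) *:
  act (dpow j f) (n1' j - i%:Z) (act (dpow k g) (n2' k - N + i%:Z) m).
pose B3 J (j k : nat) := \sum_(i < J) C (- n1' j - 1) i *:
  act (star (n0 - i%:Z) (dpow j f) (dpow k g)) (n2' k + n1' j + 1 + i%:Z) m.
have bor : \forall J \near \oo, forall jk : 'I_E * 'I_E,
    B1 J jk.1 jk.2 - (-1) ^ N *: B2 J jk.1 jk.2 = B3 J jk.1 jk.2.
  apply: filter_forall => jk.
  exact: (borcherds_act HV truncM jacobiM (dpow jk.1 f) (dpow jk.2 g) n0 (n1' jk.1) (n2' jk.2) m).
have [J0 _ HJ] := bor; exists (maxn J0 E) => // J /= hJ.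
have {}HJ : forall j k : 'I_E, B2 J j k - (-1) ^ N *: B1 J j k = (-1) ^ n0 *: B3 J j k.
  move=> j k; have J0J : (J0 <= J)%N by exact: leq_trans (leq_maxl _ _) hJ.
  rewrite -(HJ J J0J (j, k)) /= scalerBr scalerA -expfzDr ?oppr_eq0 ?oner_eq0 //.
  have -> : n0 + N = -1 by rewrite /N; lia.
  have -> : (-1) ^ n0 = - (-1) ^ N :> K.
    have -> : N = - (n0 + 1) by rewrite /N; lia.
    rewrite -exprz_inv invrN invr1 expfzDr ?oppr_eq0 ?oner_eq0 // expr1z; ring.
  by rewrite exprN1 invrN invr1 scaleN1r opprK scaleNr addrC.
have EJ : (E <= J)%N by exact: leq_trans (leq_maxr _ _) hJ.
pose s : K := (-1) ^ (a + b).
have sE : s = (-1) ^ a * (-1) ^ b by rewrite /s expfzDr // oppr_eq0 oner_eq0.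
have aopEf n m' : aop a f n m' =
    (-1) ^ a *: \sum_(q < E) act (dpow q f) (q%:Z - 2 * a - n) m'.
  by apply: aopE => //; rewrite /E; lia.
have aopEg n m' : aop b g n m' =
    (-1) ^ b *: \sum_(q < E) act (dpow q g) (q%:Z - 2 * b - n) m'.
  by apply: aopE => //; rewrite /E; lia.
have sum1 : \sum_(i < J) ((-1) ^+ i * C N i) *:
     aop a f (n1 - N + i%:Z) (aop b g (n2 - i%:Z) m)
   = s *: \sum_(j < E) \sum_(k < E) B2 J j k.
  under [in RHS]eq_bigr do rewrite exchange_big.
  rewrite exchange_big scaler_sumr; apply: eq_bigr => i _.
  rewrite aopEf aopEg scalerA [LHS]scaler_sumr [RHS]scaler_sumr.
  apply: eq_bigr => j _ /=.
  rewrite (linZ (actM_linear _ _)) (lin_sum (actM_linear _ _)).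
  rewrite !scaler_sumr; apply: eq_bigr => k _.
  have -> : n1' j - i%:Z = j%:Z - 2 * a - (n1 - N + i%:Z) by rewrite /n1'; lia.
  have -> : n2' k - N + i%:Z = k%:Z - 2 * b - (n2 - i%:Z) by rewrite /n2'; lia.
  by rewrite !scalerA sE; congr (_ *: _); ring.
have sum2 : \sum_(i < J) ((-1) ^+ i * C N i) *:
     aop b g (n2 - N + i%:Z) (aop a f (n1 - i%:Z) m)
   = s *: \sum_(j < E) \sum_(k < E) B1 J j k.
  rewrite [X in _ *: X]exchange_big /=.
  under [in RHS]eq_bigr do rewrite exchange_big.
  rewrite exchange_big scaler_sumr; apply: eq_bigr => i _.
  rewrite aopEf aopEg scalerA [LHS]scaler_sumr [RHS]scaler_sumr.
  apply: eq_bigr => j _ /=.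
  rewrite (linZ (actM_linear _ _)) (lin_sum (actM_linear _ _)).
  rewrite !scaler_sumr; apply: eq_bigr => k _.
  have -> : n2' j - i%:Z = j%:Z - 2 * b - (n2 - N + i%:Z) by rewrite /n2'; lia.
  have -> : n1' k - N + i%:Z = k%:Z - 2 * a - (n1 - i%:Z) by rewrite /n1'; lia.
  by rewrite !scalerA sE; congr (_ *: _); ring.
rewrite sum1 sum2 scalerA [_ * s]mulrC -scalerA -scalerBr.
have -> : \sum_(j < E) \sum_(k < E) B2 J j k
    - (-1) ^ N *: (\sum_(j < E) \sum_(k < E) B1 J j k)
    = (-1) ^ n0 *: \sum_(j < E) \sum_(k < E) B3 J j k.
  rewrite !scaler_sumr -sumrB; apply: eq_bigr => j _.
  by rewrite !scaler_sumr -sumrB; apply: eq_bigr => k _; exact: HJ.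
(* After the instances are used, the operator indices on both sides depend on
   the total order only. *)
pose base := - 2 * a - 2 * b - n1 - n2 + 2 * N + 1.
have B3E : \sum_(j < E) \sum_(k < E) B3 J j k = \sum_(e < E) act (diag_sum3 e
  (fun i j k => C (n0 + 2 * a - 1 - (- n1 - 1) - j%:Z) i *:
    star (n0 - i%:Z) (dpow j f) (dpow k g))) (base + e%:Z) m.
  pose G (i j k : nat) := C (- n1' j - 1) i *:
     act (star (n0 - i%:Z) (dpow j f) (dpow k g)) (base + (i + j + k)%:Z) m.
  transitivity (\sum_(j < E) \sum_(k < E) \sum_(i < J) G i j k).
    apply: eq_bigr => j _; apply: eq_bigr => k _; apply: eq_bigr => i _.
    rewrite /G; congr (_ *: act _ _ _); rewrite /base /n1' /n2'; lia.
  rewrite (@box_sum3 _ _ E E J E G) // => [|i j k Eijk]; last first.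
    rewrite /G [star _ _ _](_ : _ = 0) ?(lin0 (act_linear_form _ _ _)) ?scaler0 //.
    have h := hom_star HV (n := n0 - i%:Z) (hom_dpow HV Hrho (q := j) fa)
                (hom_dpow HV Hrho (q := k) gb).
    by apply: (hom_lowest HV bounded h); move: Eijk; rewrite /E; lia.
  apply: eq_bigr => e _; rewrite /diag_sum3 /diag_sum (lin_sum (act_linear_form _ _ _)).
  apply: eq_bigr => k _; rewrite (lin_sum (act_linear_form _ _ _)).
  apply: eq_bigr => j _; rewrite (linZ (act_linear_form _ _ _)) /G.
  have ke := ltn_ord k; have je := ltn_ord j.
  have -> : (e - k - j + j + k)%N = e by lia.
  by have -> : - n1' j - 1 = n0 + 2 * a - 1 - (- n1 - 1) - j%:Z by rewrite /n1' /N; lia.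
rewrite B3E.
pose G (i q : nat) := ((-1) ^+ i * C (- n1 - 1) i) *:
   act (dpow q (star (n0 - i%:Z) f g)) (base + (i + q)%:Z) m.
transitivity (s *: ((-1) ^ n0 *: \sum_(i < J) \sum_(q < J) G i q)).
  congr (_ *: (_ *: _)); rewrite (@box_sum _ _ J J E G) // => [|i q Eiq]; last first.
    rewrite /G (_ : dpow _ _ = 0) ?(lin0 (act_linear_form _ _ _)) ?scaler0 //.
    apply: (dpow_lowest (hom_star HV (n := n0 - i%:Z) fa gb)).
    by move: Eiq; rewrite /E; lia.
  apply: eq_bigr => e _; rewrite (star_dpow e g n0 (- n1 - 1) fa).
  rewrite /diag_sum (lin_sum (act_linear_form _ _ _)); apply: eq_bigr => q _.
  have qe := ltn_ord q; rewrite (linZ (act_linear_form _ _ _)) /G.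
  by have -> : (e - q + q)%N = e by lia.
rewrite !scaler_sumr; apply: eq_bigr => i _.
rewrite (aopE _ _ (Q := J) (hom_star HV fa gb)); last by move: EJ; rewrite /E; lia.
rewrite !scaler_sumr; apply: eq_bigr => q _; rewrite /G !scalerA.
have -> : base + (i + q)%:Z =
  q%:Z - 2 * (a + b + (n0 - i%:Z)) - (n2 + n1 + 1 + i%:Z) by rewrite /base /N; lia.
congr (_ *: _).
have u : (-1 : K) != 0 by rewrite oppr_eq0 oner_eq0.
have -> : (-1) ^ (a + b + (n0 - i%:Z)) = s * ((-1) ^ n0 * (-1) ^+ i).
  by rewrite expfzDr // -/s expfzDr // -exprz_inv invrN invr1.
ring.
Qed.

End Comodule.
End AdjointAction.

(** * The twist by L(0) and L(-1) *)

Section Twist.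
Local Open Scope classical_set_scope.
Context {K : numFieldType} {V : lmodType K} {gV : int -> set V}.
Context {DV : int -> {linear V -> (V ⊗ V)%type}} {c rho : {linear V -> K^o}} {d : K}.
Hypothesis HV : graded_voc gV DV c rho d.
Hypothesis Hrho : forall (s : int) (v : V), s <> 2 -> gV s v -> rho v = 0.
Local Notation V' := (gdual gV).
Local Notation hom := (gdual_part (G := gV)).
Local Notation LV := (Lop rho DV).
Local Notation dpow := (divided_power HV Hrho).
Local Notation twist := (twist_coef gV LV).
Implicit Types (f g : V') (n a b p : int).

Let gradV := voc_graded HV.
Let finV := voc_finite HV.

Lemma L_degree s v : gV s v -> gV (s + 1) (LV (- 1) v).
Proof.
move=> Gv; apply: (hom_mem gradV finV) => j f js fj.
have <- : Ldual HV Hrho f v = f (LV (- 1) v) by exact: star_rho.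
apply: (hom_Ldual HV Hrho fj) Gv; lia.
Qed.

Lemma exp_coef_linear j : linear (exp_coef LV j).
Proof.
case: j => q a u v; last by rewrite /= scaler0 addr0.
rewrite /= !scalerA [a * _]mulrC -scalerA -scalerDr; congr (_ *: _).
by elim: q => //= q ->; rewrite (LV_linear _ _).
Qed.

Lemma exp_coef_degree (q : nat) s v : gV s v -> gV (s + q%:Z) (exp_coef LV q v).
Proof.
move=> Gv; apply: subspace_scale (gradV.1 _) _.
elim: q => [|q IH] /=; first by rewrite addr0.
by have := L_degree IH; congr gV; lia.
Qed.

Lemma form_exp_coef f (q : nat) v : f (exp_coef LV q v) = dpow q f v.
Proof.
rewrite [LHS](linZ (gdual_linear f)) [RHS](linZ (ev_linear v)); congr (_ *: _).
elim: q v => [//|q IH] v; rewrite iterSr IH iterS.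
by symmetry; exact: (star_rho HV Hrho (- 3)).
Qed.

Lemma zpow_coefE t v : zpow_coef gV (- (2 * t)) v = (-1) ^ t *: hcomp gV t v.
Proof.
rewrite /zpow_coef [X in \sum_(s \in X) _](_ : _ = [set t]) ?fsbig_set1 //.
by apply/seteqP; split=> s /= e; lia.
Qed.

Lemma zpow_coef0 (i : int) v : (forall t, i <> - (2 * t)) -> zpow_coef gV i v = 0.
Proof.
move=> it; rewrite /zpow_coef [X in \sum_(s \in X) _](_ : _ = set0) ?fsbig_set0 //.
by apply/seteqP; split=> s //= e; case: (it s).
Qed.

Lemma zpow_coefP (i : int) : (exists t : int, i = - (2 * t)) \/ (forall t : int, i <> - (2 * t)).
Proof.
by case: (pselect (exists t : int, i = - (2 * t))) => [|n]; [left|right => t it; apply: n; exists t].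
Qed.

Lemma zpow_coef_linear i : linear (zpow_coef gV i).
Proof.
move=> a u v; case: (zpow_coefP i) => [[t ->]|it]; last first.
  by rewrite !zpow_coef0 // scaler0 addr0.
by rewrite !zpow_coefE (hcomp_linear gradV) scalerDr !scalerA [a * _]mulrC.
Qed.

Lemma twist_support p v : exists B : nat, forall i : int,
  (B <= absz i)%N -> zpow_coef gV i (exp_coef LV (p - i) v) = 0.
Proof.
move: v; apply: (graded_ind gradV (A := fun v => exists B : nat, forall i : int,
  (B <= absz i)%N -> zpow_coef gV i (exp_coef LV (p - i) v) = 0)) => [|s v Gv].
  split=> [|a u v [B B0] [B' B'0]].
    by exists 0%N => i _; rewrite (lin0 (exp_coef_linear _)) (lin0 (zpow_coef_linear _)).
  exists (maxn B B') => i; rewrite geq_max => /andP[iB iB'].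
  by rewrite exp_coef_linear zpow_coef_linear B0 // B'0 // scaler0 addr0.
exists (absz (2 * (s + p))).+1 => i iB.
case: (zpow_coefP i) => [[t it]|it]; last exact: zpow_coef0.
rewrite it zpow_coefE; case e: (p - - (2 * t)) => [q|q]; last first.
  by rewrite /= (lin0 (hcomp_linear gradV _)) scaler0.
rewrite (hcomp_id gradV _ (exp_coef_degree q Gv)); case: eqP => [ts|_].
  by move: iB; lia.
by rewrite scaler0.
Qed.

(** L(-1)^q raises degrees by q, so that of all terms of degree b in the twist of
    v only one has the exponent p, at q = p + 2b. *)
Lemma form_twist b f p v : hom b f ->
  f (twist p v) = (-1) ^ b * (if p + 2 * b is Posz q then dpow q f v else 0).
Proof.
move=> fb; have [B B0] := twist_support p v.
rewrite /twist_coef (@fsum_int _ _ (- (B%:Z)) (2 * B)); last first.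
  by move=> i ni; apply: B0; lia.
rewrite (lin_sum (gdual_linear f)) -(@fsum_int _
  (fun i => f (zpow_coef gV i (exp_coef LV (p - i) v)) : K^o)); last first.
  move=> i ni; rewrite B0 ?(lin0 (gdual_linear f)) //; lia.
rewrite (fsum_single (i0 := - (2 * b))) => [|i ib].
  rewrite zpow_coefE (linZ (gdual_linear f)) (hom_hcomp gradV) //.
  rewrite opprK; congr (_ * _); case: (p + 2 * b) => q; first exact: form_exp_coef.
  exact: lin0 (gdual_linear f).
case: (zpow_coefP i) => [[t it]|it]; last first.
  by rewrite zpow_coef0 // (lin0 (gdual_linear f)).
rewrite it zpow_coefE (linZ (gdual_linear f)) (fb t) ?scaler0 //.
  by move=> tb; apply: ib; rewrite it tb.
exact: hcomp_in.
Qed.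

Lemma twist_linear p : linear (twist p).
Proof.
move=> a u v; apply/eqP; rewrite -subr_eq0; apply/eqP.
apply: (hom_separate gradV finV) => b f fb; have lf := gdual_linear f.
rewrite (linB lf) lf !(form_twist _ _ fb).
case: (p + 2 * b) => q; last by rewrite mulr0 scaler0 addr0 subrr.
rewrite (gdual_linear (dpow q f)) mulrDr -[a *: (_ * _)]/(a * (_ * _)).
rewrite -[a *: _]/(a * _).
by rewrite [(-1) ^ b * (a * _)]mulrCA subrr.
Qed.

End Twist.

(** * Degrees in an admissible comodule *)

Section ComoduleDegrees.
Local Open Scope classical_set_scope.
Context {K : numFieldType} {V M : lmodType K} {gV : int -> set V} {gM : nat -> set M}.

(** Continuing the grading of M by 0 to negative degrees spares the case
    distinction whether an operator lowers the degree too far. *)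
Definition int_grading (s : int) : set M := if s is Posz t then gM t else [set 0].

Hypothesis gradM : graded_by gM.

Lemma int_grading_subspace s : subspace (int_grading s).
Proof.
case: s => t /=; first exact: gradM.1.
by split=> // a u v -> ->; rewrite scaler0 addr0.
Qed.

Lemma int_grading_eq0 s (h : gdual gM) (B : nat) m :
  (forall t u, (B <= t)%N -> gM t u -> h u = 0) -> B%:Z <= s ->
  int_grading s m -> h m = 0.
Proof.
by move=> hB Bs; case: s Bs => t Bt //= Gm; apply: hB Gm; lia.
Qed.

Lemma gdual_bounded (h : gdual gM) :
  exists B : nat, forall t u, (B <= t)%N -> gM t u -> h u = 0.
Proof.
have /finite_fsetP[X XE] := gdual_finite h.
exists (\max_(i <- X) i).+1 => t u tB Gu; apply: contrapT => /eqP hu.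
have : [set` X] t by rewrite -XE; exists u.
move=> /= tX; by have := @leq_bigmax_seq _ (X : seq nat) xpredT id t tX isT; rewrite leqNgt tB.
Qed.

Context {DM : int -> {linear M -> (V ⊗ M)%type}}.
Hypothesis degM : forall (k : int) (t : nat) m, gM t m ->
  lspan [set x | exists (s : nat) v w,
    [/\ gV (t%:Z + k + 1 - s%:Z) v, gM s w & x = v ⊗ w]] (DM k m).

Lemma act_degree b (f : gdual gV) n t m : gdual_part b f -> int_grading t m ->
  int_grading (t - n - b) (act DM f n m).
Proof.
move=> fb; case: t => t /=; last first.
  by move=> ->; rewrite (lin0 (actM_linear _ _)); exact: (int_grading_subspace _).1.
move=> Gm; have lf := gdual_linear f.
have : subspace [set x : (V ⊗ M)%type | int_grading (t%:Z - n - b) (tforml f x)].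
  have sG := int_grading_subspace (t%:Z - n - b).
  split=> [|a x y /= xG yG]; first by rewrite /= (lin0 (tforml_linear lf)); exact: sG.1.
  by rewrite (tforml_linear lf); apply: sG.2.
move=> /lspan_min; apply; last exact: degM Gm.
move=> _ [s [v [w [Gv Gw ->]]]] /=; rewrite tformlE //.
have [e|/eqP ne] := eqVneq (t%:Z + (- n - 1) + 1 - s%:Z) b.
  have -> : t%:Z - n - b = s by lia.
  by apply: subspace_scale => //=; exact: gradM.1.
by rewrite (fb _ _ ne Gv) scale0r; exact: (int_grading_subspace _).1.
Qed.

End ComoduleDegrees.

(** * Existence of the contragredient structure map *)

Section Contragredient.
Local Open Scope classical_set_scope.
Context {K : numFieldType} {V : lmodType K} {gV : int -> set V}.
Context {DV : int -> {linear V -> (V ⊗ V)%type}} {c rho : {linear V -> K^o}} {d : K}.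
Hypothesis HV : graded_voc gV DV c rho d.
Hypothesis Hrho : forall (s : int) (v : V), s <> 2 -> gV s v -> rho v = 0.
Variable lowest : int.
Hypothesis bounded : forall s, s < lowest -> gV s = [set 0].
Context {M : lmodType K} {gM : nat -> set M} {DM : int -> {linear M -> (V ⊗ M)%type}}.
Hypothesis HM : admissible_comodule gV DV c rho d gM DM.
Hypothesis finM : forall s : nat, finite_dim (gM s).
Local Notation V' := (gdual gV).
Local Notation M' := (gdual gM).
Local Notation hom := (gdual_part (G := gV)).
Local Notation LV := (Lop rho DV).
Local Notation LM := (Lop rho DM).
Local Notation C := (@binomz K).
Local Notation star := (star HV).
Local Notation rho_form := (rho_form Hrho).
Local Notation counit_form := (counit_form HV).
Local Notation dpow := (divided_power HV Hrho).
Local Notation twist := (twist_coef gV LV).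
Local Notation aop := (adjoint_act HV Hrho lowest (DM := DM)).
Local Notation gMz := (@int_grading K M gM).
Implicit Types (f g : V') (h : M') (n a b p : int) (m : M).

Let gradV := voc_graded HV.
Let finV := voc_finite HV.
Let gradM := com_graded HM.

Let zcoefM_linear n : linear (zcoef DM n).
Proof. by move=> a x y; rewrite /zcoef linearP. Qed.

Lemma aop_degree b f n (t : int) m : hom b f -> gMz t m -> gMz (t + n + b) (aop b f n m).
Proof.
move=> fb Gm; have sG := int_grading_subspace gradM (t + n + b).
apply: (subspace_scale _ sG); apply: (@subspace_sum K M _ _ _ _ _ sG) => q _.
have := act_degree gradM (com_degree HM) (q%:Z - 2 * b - n) (hom_dpow HV Hrho (q := q) fb) Gm.
by congr (gMz _ _); lia.
Qed.

Lemma aop_eq0 b f n (B t : nat) h m :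
  (forall t u, (B <= t)%N -> gM t u -> h u = 0) -> B%:Z <= t%:Z + n + lowest ->
  hom b f -> gM t m -> h (aop b f n m) = 0.
Proof.
move=> hB Bt fb Gm; have [bl|lb] := ltP b lowest.
  rewrite (hom_lowest HV bounded fb bl) /adjoint_act big1 ?scaler0 ?(lin0 (gdual_linear h)) //.
  by move=> q _; rewrite (lin0 (dpow_linear HV Hrho q)) (lin0 (act_linear_form _ _ _)).
have Gt : gMz t m by [].
by apply: (int_grading_eq0 hB _ (aop_degree n fb Gt)); lia.
Qed.

(** The summand with exponent p in the coefficient of z^n of Υ'(z)h, evaluated
    at m and seen as a vector in V. *)
Let summand n h m p : V := tformr h (tmap (twist p) id (zcoef DM (- (n - p)) m)).

Let summand_linear n h p : linear (fun m => summand n h m p).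
Proof.
apply: comp_linear (tformr_linear (gdual_linear h)).
exact: comp_linear (zcoefM_linear _) (tmap_linear (twist_linear HV Hrho p) _).
Qed.

Let form_summand n h m p b f : hom b f -> f (summand n h m p) =
  (-1) ^ b * (if p + 2 * b is Posz q then h (act DM (dpow q f) (- (n - p)) m) else 0).
Proof.
move=> fb; have lf := gdual_linear f; have lh := gdual_linear h.
have lw := twist_linear HV Hrho p.
rewrite /summand -(tpair_tformr _ lf lh) tpair_tforml //.
rewrite (tforml_tmap (W := M) (W' := M)) //.
have -> : (fun v => f (twist p v)) = gdual_fun
    ((-1) ^ b *: (if p + 2 * b is Posz q then dpow q f else 0)).
  apply: funext => v; rewrite (form_twist HV Hrho p v fb) (linZ (ev_linear v)).
  by case: (p + 2 * b) => q //; rewrite [in RHS](lin0 (ev_linear v)).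
rewrite (linZ (tforml_linear_form _)) (linZ lh); congr (_ * _).
by case: (p + 2 * b) => q //; rewrite (lin0 (tforml_linear_form _)) (lin0 lh).
Qed.

(** Although [twist] has infinitely many terms on V, only finitely many summands
    survive the pairing with h: truncation of Υ bounds p from above, and the
    degree of the result, which does not depend on p, bounds it from below. *)
Let summand_support n h m : exists B : nat, forall p : int, (B <= absz p)%N ->
  summand n h m p = 0.
Proof.
move: m; apply: (graded_ind gradM (A := fun m => exists B : nat, forall p : int,
  (B <= absz p)%N -> summand n h m p = 0)) => [|t m Gm].
  split=> [|a u v [B B0] [B' B'0]].
    by exists 0%N => p _; rewrite (lin0 (summand_linear n h p)).
  exists (maxn B B') => p; rewrite geq_max => /andP[pB pB'].
  by rewrite (summand_linear n h p a u v) B0 // B'0 // scaler0 addr0.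
have [N N0] := zcoef_trunc (com_truncated HM) m.
have [B hB] := gdual_bounded h.
exists (absz (N + n)%R + absz (2 * (B%:Z - t%:Z - n))%R).+1 => p pB.
have [pN|pN] := leP (N + n) p.
  have lt := tmap_linear (twist_linear HV Hrho p) (@id_linear K M).
  rewrite /summand N0 ?(lin0 lt) ?(lin0 (tformr_linear (gdual_linear h))) //; lia.
apply: (hom_separate gradV finV) => b f fb; rewrite (form_summand n h m p fb).
case e: (p + 2 * b) => [q|q]; last by rewrite mulr0.
have Gt : gMz t m by [].
have := act_degree gradM (com_degree HM) (- (n - p)) (hom_dpow HV Hrho (q := q) fb) Gt.
by move=> /(int_grading_eq0 hB) ->; [rewrite mulr0|lia].
Qed.

Let value n h m : V := \sum_(p \in [set: int]) summand n h m p.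

Let form_value_sum n h m (f : V -> K^o) : linear f ->
  f (value n h m) = \sum_(p \in [set: int]) f (summand n h m p).
Proof.
move=> lf; have [B B0] := summand_support n h m.
rewrite /value (@fsum_int _ _ (- (B%:Z)) (2 * B)) => [|p np]; last by apply: B0; lia.
rewrite (lin_sum lf) (@fsum_int _ _ (- (B%:Z)) (2 * B)) => [//|p np].
by rewrite B0 ?(lin0 lf) //; lia.
Qed.

Let form_value n h m b f : hom b f -> f (value n h m) = h (aop b f n m).
Proof.
move=> fb; have lh := gdual_linear h.
rewrite (form_value_sum n h m (gdual_linear f)).
rewrite (fsum_inj (e := fun q => q%:Z - 2 * b) (J := (absz (b - lowest)).+1)).
- rewrite /adjoint_act (linZ lh) (lin_sum lh) scaler_sumr; apply: eq_bigr => q _.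
  rewrite (form_summand n h m _ fb) subrK; congr (_ * h (act _ _ _ _)); lia.
- by move=> q r /eqP; rewrite (inj_eq (addIr _)) => /eqP [].
move=> p np; rewrite (form_summand n h m p fb); case e: (p + 2 * b) => [q|q]; last first.
  by rewrite mulr0.
rewrite (dpow_lowest HV Hrho bounded (q := q) fb).
  by rewrite (lin0 (act_linear_form _ _ _)) (lin0 lh) mulr0.
have := np q; lia.
Qed.

Let value_linear n h : linear (value n h).
Proof.
move=> a u v; apply/eqP; rewrite -subr_eq0; apply/eqP.
apply: (hom_separate gradV finV) => b f fb; have lf := gdual_linear f.
rewrite (linB lf) lf !(form_value n h _ fb) (aop_linear _ _ _ _ _) (gdual_linear h).
by rewrite subrr.
Qed.

Lemma tens_pair_separate (x : V ⊗ M') : (forall b f m, hom b f ->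
  tpair f (fun h => h m) x = 0) -> x = 0.
Proof.
move=> x0; apply: (tens_separate (hom_separating gradV finV)) => _ [b [f [fb ->]]].
apply: gdual_ext => m; rewrite (lin0 (ev_linear m)) -(x0 b f m fb).
by rewrite tpair_tforml //; exact: gdual_linear.
Qed.

(** A linear map from M to V that vanishes in large degrees is given by a
    tensor, as the homogeneous subspaces of M have dual bases. *)
Lemma linear_map_tensor (U : M -> V) (T : nat) : linear U ->
  (forall t m, (T <= t)%N -> gM t m -> U m = 0) ->
  exists x : V ⊗ M', (forall m, tformr (fun h : M' => h m) x = U m) /\
    lspan [set y | exists t e h, [/\ gM t e, gdual_part t h & y = U e ⊗ h]] x.
Proof.
move=> lU U0; set S := [set y | _].
have /choice[x xP] (t : nat) : exists x : V ⊗ M',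
    (forall m, tformr (fun h : M' => h m) x = U (hcomp gM t m)) /\ lspan S x.
  have [k [e [phi [eG phiG hE]]]] := dual_basis gradM (finM t).
  exists (\sum_j U (e j) ⊗ phi j); split=> [m|].
    rewrite (lin_sum (tformr_linear (ev_linear m))) hE (lin_sum lU).
    by apply: eq_bigr => j _; rewrite (linZ lU) tformrE //; exact: ev_linear.
  apply: (@subspace_sum K _ _ _ _ _ _ (subspace_lspan S)) => j _; apply: lspan_gen.
  by exists t, (e j), (phi j).
exists (\sum_(t < T) x t); split=> [m|]; last first.
  by apply: (@subspace_sum K _ _ _ _ _ _ (subspace_lspan S)) => t _; exact: (xP t).2.
rewrite (lin_sum (tformr_linear (ev_linear m))).
under eq_bigr => t _ do rewrite (xP t).1.
move: m; apply: (graded_ind gradM); first apply: (subspace_eq _ lU).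
  move=> a u v; rewrite scaler_sumr -big_split; apply: eq_bigr => t _.
  by rewrite (hcomp_linear gradM) lU.
move=> s m Gm /=; under eq_bigr => t _ do rewrite (hcomp_id gradM _ Gm).
have [sT|Ts] := ltnP s T.
  rewrite (bigD1 (Ordinal sT)) //= eqxx big1 ?addr0 // => t /negPf ts.
  by have -> : (t == s :> nat) = false by []; rewrite (lin0 lU).
rewrite (U0 _ _ Ts Gm) big1 // => t _; case: eqP => [ts|_]; last exact: (lin0 lU).
by have := ltn_ord t; rewrite ts ltnNge Ts.
Qed.

Let value_degree (k : int) (t s : nat) h e : gdual_part t h -> gM s e ->
  gV (t%:Z + k + 1 - s%:Z) (value (- k - 1) h e).
Proof.
move=> ht Gs; apply: (hom_mem gradV finV) => b f nb fb.
rewrite (form_value _ _ _ fb); have Gz : gMz s e by [].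
have := aop_degree (- k - 1) fb Gz.
case E: (s%:Z + (- k - 1) + b) => [r|r] /=; last by move=> ->; exact: (lin0 (gdual_linear h)).
by apply: ht => rt; apply: nb; lia.
Qed.

Let coef_exists (k : int) h : exists x : V ⊗ M',
  (forall m, tformr (fun h : M' => h m) x = value (- k - 1) h m) /\
  lspan [set y | exists t e (g : M'),
    [/\ gM t e, gdual_part t g & y = value (- k - 1) h e ⊗ g]] x.
Proof.
have [B hB] := gdual_bounded h.
have l := linear_map_tensor (T := absz (B%:Z + k + 1 - lowest)%R) (value_linear (- k - 1) h).
apply: l => t m Tt Gm; apply: (hom_separate gradV finV) => b f fb.
by rewrite (form_value _ _ _ fb); apply: (aop_eq0 hB _ fb Gm); lia.
Qed.

(** The values at m of the coefficients of Υ'(z)h vanish for m of large degree,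
    and so come from tensors.  Those are unique, hence linear in h. *)
Lemma contragredient_exists : exists D' : int -> {linear M' -> (V ⊗ M')%type},
  [/\ contragredient gV LV DM D',
      forall b f n h m, hom b f -> act D' f n h m = h (aop b f n m)
    & forall (k : int) (t : nat) h, gdual_part t h ->
        lspan [set x | exists (s : nat) v w, [/\ gV (t%:Z + k + 1 - s%:Z) v,
          gdual_part s w & x = v ⊗ w]] (D' k h)].
Proof.
have /choice[E EP] (kh : int * M') := coef_exists kh.1 kh.2.
have pairE k h b f m : hom b f ->
    tpair f (fun h : M' => h m) (E (k, h)) = h (aop b f (- k - 1) m).
  move=> fb; rewrite tpair_tformr; [|exact: gdual_linear|exact: ev_linear].
  by rewrite (EP (k, h)).1 (form_value _ _ _ fb).
have E_linear k : linear (fun h => E (k, h)).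
  move=> a u v; apply/eqP; rewrite -subr_eq0; apply/eqP.
  apply: tens_pair_separate => b f m fb.
  have l := tpair_linear (gdual_linear f) (ev_linear (G := gM) m).
  by rewrite (linB l) l !(pairE _ _ _ _ _ fb) [X in X - _]ev_linear subrr.
exists (fun k => mklinear (E_linear k)).
have kn (n : int) : - (- n - 1) - 1 = n by lia.
split=> [m h f n|b f n h m fb|k t h ht].
- rewrite tpair_tformr; [|exact: gdual_linear|exact: ev_linear].
  rewrite /zcoef /= (EP (- n - 1, h)).1 kn (form_value_sum _ _ _ (gdual_linear f)).
  apply: eq_fsbigr => p _.
  by rewrite -tpair_tformr //; exact: gdual_linear.
- rewrite /act /zcoef /= -[LHS](tpair_tforml _ (gdual_linear f) (ev_linear m)).
  by rewrite (pairE _ _ _ _ _ fb) kn.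
- apply: (lspan_min (subspace_lspan _)) (EP (k, h)).2.
  move=> _ [s [e [g [Ge gs ->]]]]; apply: lspan_gen.
  by exists s, (value (- k - 1) h e), g; split=> //; exact: value_degree.
Qed.

End Contragredient.

(** * The contragredient comodule is admissible *)

Section Admissible.
Local Open Scope classical_set_scope.
Context {K : numFieldType} {V : lmodType K} {gV : int -> set V}.
Context {DV : int -> {linear V -> (V ⊗ V)%type}} {c rho : {linear V -> K^o}} {d : K}.
Hypothesis HV : graded_voc gV DV c rho d.
Hypothesis Hrho : forall (s : int) (v : V), s <> 2 -> gV s v -> rho v = 0.
Variable lowest : int.
Hypothesis bounded : forall s, s < lowest -> gV s = [set 0].
Context {M : lmodType K} {gM : nat -> set M} {DM : int -> {linear M -> (V ⊗ M)%type}}.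
Hypothesis HM : admissible_comodule gV DV c rho d gM DM.
Local Notation V' := (gdual gV).
Local Notation M' := (gdual gM).
Local Notation hom := (gdual_part (G := gV)).
Local Notation LV := (Lop rho DV).
Local Notation LM := (Lop rho DM).
Local Notation C := (@binomz K).
Local Notation star := (star HV).
Local Notation rho_form := (rho_form Hrho).
Local Notation counit_form := (counit_form HV).
Local Notation dpow := (divided_power HV Hrho).
Local Notation aop := (adjoint_act HV Hrho lowest (DM := DM)).
Local Notation gMz := (@int_grading K M gM).
Implicit Types (f g : V') (h : M') (n a b p : int) (m : M).

Let gradV := voc_graded HV.
Let finV := voc_finite HV.
Let gradM := com_graded HM.
Let truncM := com_truncated HM.
Let jacobiM := com_jacobi HM.

(** The sum has a single term, since all higher divided powers of f vanish; this
    applies to c and to ρ. *)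
Lemma aop_Ldual0 a f n m : Ldual HV Hrho f = 0 ->
  aop a f n m = (-1) ^ a *: act DM f (- (2 * a) - n) m.
Proof.
move=> Lf; rewrite /adjoint_act big_ord_recl dpow0 big1 ?addr0 => [|q _].
  by congr (_ *: act _ _ _ _) => /=; lia.
have -> : dpow (lift ord0 q) f = 0.
  have iter0 k : iter k (Ldual HV Hrho) 0 = 0.
    by elim: k => // k IH; rewrite iterS IH (lin0 (Ldual_linear HV Hrho)).
  by rewrite /divided_power [val _]/= /bump add1n iterSr Lf iter0 scaler0.
by rewrite (lin0 (act_linear_form _ _ _)).
Qed.

(** In the sum over q, the terms that raise the power of L shift q by one and
    combine with the others to the constant factor n + 1. *)
Lemma aop_L b f n m : hom b f ->
  LM (- 1) (aop b f n m) - aop b f n (LM (- 1) m) = (n + 1)%:~R *: aop b f (n + 1) m.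
Proof.
move=> fb; set Q := (absz (b - lowest)).+1.
have lL : linear (LM (- 1)).
  have lr : linear (rho : V -> K^o) := linearP rho.
  by apply: comp_linear (tforml_linear lr) => a x y; rewrite /zcoef linearP.
pose F (q : nat) := act DM (dpow q f) (q%:Z - 2 * b - (n + 1)) m.
have shift : \sum_(q < Q) q.+1%:R *: F q.+1 = \sum_(q < Q) q%:R *: F q.
  transitivity (\sum_(q < Q.+1) q%:R *: F q).
    by rewrite [RHS]big_ord_recl scale0r add0r.
  rewrite big_ord_recr /= /F (dpow_lowest HV Hrho bounded (q := Q) fb); last by lia.
  by rewrite (lin0 (act_linear_form _ _ _)) scaler0 addr0.
rewrite /adjoint_act -/Q (linZ lL) -scalerBr [RHS]scalerA [in RHS]mulrC -[RHS]scalerA; congr (_ *: _).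
rewrite (lin_sum lL) -sumrB.
have comm (q : nat) : act DM (dpow q f) (q%:Z - 2 * b - n) (LM (- 1) m)
     - LM (- 1) (act DM (dpow q f) (q%:Z - 2 * b - n) m)
   = (- (q%:R + (n + 1)%:~R)) *: F q + q.+1%:R *: F q.+1.
  rewrite (L_commutator HV Hrho truncM jacobiM _ _ _ (hom_dpow HV Hrho (q := q) fb)).
    rewrite Ldual_dpow (linZ (act_linear_form _ _ _) _ (dpow q.+1 f)) /F.
    have -> : q%:Z - 2 * b - n - 1 = q%:Z - 2 * b - (n + 1) by lia.
    have -> : q.+1%:Z - 2 * b - (n + 1) = q%:Z - 2 * b - n by lia.
    by congr (_ *: _ + _); ring.
  by move=> u k; exact: (com_L1 HM u k).1.
have -> : \sum_(q < Q) (LM (- 1) (act DM (dpow q f) (q%:Z - 2 * b - n) m)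
     - act DM (dpow q f) (q%:Z - 2 * b - n) (LM (- 1) m))
  = - \sum_(q < Q) ((- (q%:R + (n + 1)%:~R)) *: F q + q.+1%:R *: F q.+1).
  by rewrite -sumrN; apply: eq_bigr => q _; rewrite -comm opprB.
rewrite big_split shift -big_split /= -sumrN scaler_sumr; apply: eq_bigr => q _.
by rewrite -scalerDl -scaleNr; congr (_ *: _); ring.
Qed.

Context {D' : int -> {linear M' -> (V ⊗ M')%type}}.
Hypothesis D'E : forall b f n h m, hom b f -> act D' f n h m = h (aop b f n m).
Hypothesis degD' : forall (k : int) (t : nat) h, gdual_part t h ->
  lspan [set x | exists (s : nat) v w, [/\ gV (t%:Z + k + 1 - s%:Z) v,
    gdual_part s w & x = v ⊗ w]] (D' k h).

Let truncD' : truncated D'.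
Proof.
move=> h; have [B hB] := gdual_bounded h.
exists (lowest - B%:Z - 1) => k kB; have -> : D' k h = zcoef D' (- k - 1) h.
  by rewrite /zcoef; congr (D' _ h); lia.
apply: (tens_separate (hom_separating gradV finV)) => _ [b [f [fb ->]]].
apply: (gdual_ext_hom gradM) => t m Gm; rewrite (lin0 (ev_linear m)).
rewrite -[LHS]/(act D' f (- k - 1) h m) (D'E _ _ _ fb).
by apply: (aop_eq0 HV Hrho bounded HM hB _ fb Gm); lia.
Qed.

Let jacobiD' : jacobi DV D'.
Proof.
pose G := [set e : M' -> K^o | exists m, e = fun h => h m].
have sepG : separating G.
  split=> [_ [m ->]|h h0]; first exact: ev_linear.
  by apply: gdual_ext => m; rewrite (lin0 (ev_linear m)); apply: (h0 (fun h => h m)); exists m.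
apply: (borcherds_jacobi truncD' (hom_separating gradV finV) sepG).
move=> _ _ _ [a [f [fa ->]]] [b [g [gb ->]]] [m ->] n0 n1 n2 h.
have [J _ HJ] := aop_borcherds HV Hrho bounded truncM jacobiM n0 n1 n2 m fa gb.
exists J => // J' J'J; have e := congr1 h (HJ J' J'J); have lh := gdual_linear h.
have le := ev_linear (G := gM) m.
rewrite (linB lh) (linZ lh) !(lin_sum lh) in e.
rewrite /borcherds_lhs /borcherds_rhs (linB le) (linZ le) !(lin_sum le).
apply: etrans (etrans _ e) _.
- congr (_ - _ *: _); apply: eq_bigr => i _; rewrite [LHS](linZ le) [RHS](linZ lh).
    congr (_ *: _); rewrite -[LHS]/(act D' g (n2 - i%:Z) (act D' f _ h) m).
    by rewrite (D'E _ _ _ gb) (D'E _ _ _ fa).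
  congr (_ *: _); rewrite -[LHS]/(act D' f (n1 - i%:Z) (act D' g _ h) m).
  by rewrite (D'E _ _ _ fa) (D'E _ _ _ gb).
- apply: eq_bigr => i _; rewrite [RHS](linZ le) [LHS](linZ lh); congr (_ *: _).
  symmetry; rewrite -[LHS]/(act D' (star (n0 - i%:Z) f g) _ h m).
  by rewrite (D'E _ _ _ (hom_star HV fa gb)).
Qed.

Let L_D' k h m : Lop rho D' k h m = h (LM (- k) m).
Proof.
have -> : Lop rho D' k h = act D' rho_form (k - 2) h by rewrite act_rho subrK.
rewrite (D'E _ _ _ (hom_rho Hrho)) (aop_Ldual0 _ _ _ (Ldual_rho HV Hrho)) act_rho.
by rewrite -[(-1) ^ 2]/((-1) ^+ 2) sqrrN expr1n scale1r; congr (h (Lop _ _ _ _)); lia.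
Qed.

Lemma contragredient_admissible :
  admissible_comodule gV DV c rho d (gdual_part (G := gM)) D'.
Proof.
split=> //.
- exact: graded_dual_graded.
- move=> h n; apply: gdual_ext => m.
  rewrite -[LHS]/(act D' counit_form n h m) (D'E _ _ _ (hom_counit HV)).
  rewrite (aop_Ldual0 _ _ _ (Ldual_counit HV Hrho)) expr0z scale1r.
  have -> : act DM counit_form (- (2 * 0) - n) m = if n == 0 then m else 0.
    rewrite [LHS](com_counit HM); congr (if _ then _ else _); lia.
  by case: eqP => // _; rewrite (lin0 (gdual_linear h)) (lin0 (ev_linear m)).
- move=> k j h; apply: gdual_ext => m; have lm := ev_linear (G := gM) m.
  have lh := gdual_linear h.
  rewrite (linB lm) (linD lm) !(linZ lm) !L_D'.
  rewrite -(linB lh) (com_virasoro HM) (linD lh) !(linZ lh).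
  have -> : - j + - k = - (k + j) by lia.
  congr (_ *: _ + _ *: _); first by congr (_%:~R); lia.
  rewrite oppr_eq0; case: eqP => // kj; have -> : j = - k by lia.
  by rewrite opprK.
- have sep_eq (x y : V ⊗ M') :
      (forall b f, hom b f -> tforml f x = tforml f y) -> x = y.
    move=> xy; apply/eqP; rewrite -subr_eq0; apply/eqP.
    apply: (tens_separate (hom_separating gradV finV)) => _ [b [f [fb ->]]].
    by rewrite (linB (tforml_linear (gdual_linear f))) (xy b f fb) subrr.
  have lD' n : linear (zcoef D' n) by move=> a x y; rewrite /zcoef linearP.
  have lL' : linear (Lop rho D' 1).
    have lr : linear (rho : V -> K^o) := linearP rho.
    exact: comp_linear (lD' _) (tforml_linear lr).
  have LactE f n h : tforml f (tmap id (Lop rho D' 1) (zcoef D' n h)) =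
      Lop rho D' 1 (act D' f n h).
    by rewrite (tforml_tmap (W := M') (W' := M')) //; exact: gdual_linear.
  have L1r h n : (n + 1)%:~R *: zcoef D' (n + 1) h =
      zcoef D' n (Lop rho D' 1 h) - tmap id (Lop rho D' 1) (zcoef D' n h).
    apply: sep_eq => b f fb; have lt := @tforml_linear K V M' _ (gdual_linear f).
    rewrite (linZ lt) (linB lt) LactE; apply: gdual_ext => m.
    have lm := ev_linear (G := gM) m; have lh := gdual_linear h.
    rewrite (linZ lm) (linB lm) L_D'.
    rewrite -[X in _ *: X]/(act D' f (n + 1) h m) -[X in _ = X - _]/(act D' f n _ m).
    by rewrite !(D'E _ _ _ fb) L_D' -(linZ lh) -(linB lh) aop_L.
  (* The last expression is also the commutator with ρ, in which the Jacobi
     identity leaves the single term that belongs to the form g ∘ L(1). *)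
  move=> h n; split=> //; rewrite L1r; apply: sep_eq => b g gb.
  have lt := @tforml_linear K V M' _ (gdual_linear g).
  have comm := commutator HV truncD' jacobiD' rho_form g 0 n h.
  rewrite big_ord1 binomz0 scale1r !(act_rho Hrho) in comm.
  have k1 : - 0%:Z - 1 + 2 = 1 :> int by [].
  rewrite k1 in comm.
  rewrite (linB lt) LactE -[X in _ = X - _]/(act D' g n _) comm.
  have -> : act D' (star (- 1 - (@ord0 0)%:Z) rho_form g) (n - 0%:Z + (@ord0 0)%:Z) h =
      act D' (star (- 1) rho_form g) n h by congr (act _ _ _ _) => /=; lia.
  rewrite (tforml_tmap (W := M') (W' := M')) //; last exact: gdual_linear.
    by congr (tforml _ _); apply: funext => v; symmetry; exact: (star_rho HV Hrho (- 1)).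
  exact: LV_linear.
Qed.

End Admissible.

(** * The theorem *)

Theorem theorem3p6 (R : realType) (V : lmodType R[i]) (gV : int -> set V)
    (DV : int -> {linear V -> (V ⊗ V)%type}) (c rho : {linear V -> R[i]^o}) (d : R[i])
    (HV : graded_voc gV DV c rho d)
    (Hrho : forall (s : int) (v : V), s <> 2 -> gV s v -> rho v = 0)
    (M : lmodType R[i]) (gM : nat -> set M) (DM : int -> {linear M -> (V ⊗ M)%type})
    (HM : admissible_comodule gV DV c rho d gM DM)
    (finM : forall s : nat, finite_dim (gM s)) :
  exists DM' : int -> {linear gdual gM -> (V ⊗ gdual gM)%type},
    [/\ contragredient gV (Lop rho DV) DM DM',
        (forall D : int -> gdual gM -> V ⊗ gdual gM,
           contragredient gV (Lop rho DV) DM D -> forall k, D k =1 DM' k)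
      & admissible_comodule gV DV c rho d (gdual_part (G := gM)) DM'].
Proof.
have [lowest bounded] := voc_bounded HV.
have [D' [D'c D'E D'deg]] := contragredient_exists HV Hrho bounded HM finM.
exists D'; split=> //; last exact: (contragredient_admissible bounded HM D'E D'deg).
move=> D Dc k h; apply/eqP; rewrite -subr_eq0; apply/eqP.
apply: (tens_pair_separate HV) => b f m _.
have lp := tpair_linear (gdual_linear f) (ev_linear (G := gM) m).
have := Dc m h f (- k - 1); rewrite -D'c /zcoef.
have -> : - (- k - 1) - 1 = k by lia.
by rewrite (linB lp) => ->; rewrite subrr.
Qed.
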